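(* $(c>0)$-\textsc{McfEnum} is in \textbf{PSDelayP}: there is an algorithm that, given a weighted temporal graph $G=(V,E)$ in which every edge has strictly positive cost and vertices $s,z\in V$, enumerates exactly all $(s,z)$-paths that are efficient with respect to duration and cost, such that the time until the first output and between any two consecutive outputs is bounded by a polynomial in the input size, and the space used is bounded by a polynomial in the input size.
   Context: A weighted temporal graph $G=(V,E)$ has temporal edges $e=(u,v,t,\lambda,c)$ with $u\neq v$, availability time $t\in\mathbb{N}$, traversal time $\lambda\in\mathbb{N}$, cost $c\in\mathbb{R}_{\ge0}$; it is given as the sequence of its edges sorted by availability time. A temporal $(u,v)$-path is a sequence $(e_1,\ldots,e_k)$, $e_i=(v_i,v_{i+1},t_i,\lambda_i,c_i)\in E$, $v_1=u$, $v_{k+1}=v$, $t_i+\lambda_i\le t_{i+1}$ for $1\le i<k$, visiting each vertex at most once; starting time $s(P)=t_1$, arrival time $a(P)=t_k+\lambda_k$, duration $d(P)=a(P)-s(P)$, cost $c(P)=\sum_i c_i$. An $(s,z)$-path $P$ is efficient w.r.t. duration and cost if no $(s,z)$-path $Q$ has ($c(Q)<c(P)$ and $d(Q)\le d(P)$) or ($c(Q)\le c(P)$ and $d(Q)<d(P)$). \textsc{McfEnum} is the task of enumerating all and only these efficient $(s,z)$-paths; $(c>0)$-\textsc{McfEnum} is its restriction to graphs with all edge costs strictly positive. An enumeration problem is in \textbf{PSDelayP} if the delay before the first and between any two consecutive outputs is polynomial in the input size and the space used is polynomial in the input size. *)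

(* Defs.v *)
(* MathComp; [realType] comes from MathComp-Analysis. *)
From HB Require Import structures.
From mathcomp Require Import all_boot all_order all_algebra.
From mathcomp Require Import reals.

Set Implicit Arguments.
Unset Strict Implicit.
Unset Printing Implicit Defensive.
Import Order.TTheory GRing.Theory Num.Theory.
Local Open Scope ring_scope.

(** * Weighted temporal graphs, on the vertex set {0, ..., n-1} *)

Record tedge (R : realType) (n : nat) := TEdge {
  src : 'I_n;
  dst : 'I_n;
  avail : nat;
  trav : nat;
  cost : R
}.

Definition tedge_tuple (R : realType) n (e : tedge R n) :=
  (src e, dst e, avail e, trav e, cost e).
Definition tuple_tedge (R : realType) n (x : 'I_n * 'I_n * nat * nat * R) :
    tedge R n :=
  let: (u, v, t, l, c) := x in TEdge u v t l c.
Lemma tedge_tupleK (R : realType) n :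
  cancel (@tedge_tuple R n) (@tuple_tedge R n).
Proof. by case. Qed.
HB.instance Definition _ (R : realType) n :=
  Equality.copy (tedge R n) (can_type (@tedge_tupleK R n)).

(* [uniq] because E is a set: two edges may share endpoints and times, but
   they are then told apart by their traversal time or cost. *)
Record tgraph (R : realType) := TGraph {
  nvert : nat;
  tedges : seq (tedge R nvert);
  tedges_uniq : uniq tedges;
  tedges_sorted : sorted (fun e f => avail e <= avail f)%N tedges;
  tedges_loopless : forall e, e \in tedges -> src e != dst e;
  tedges_cost_ge0 : forall e, e \in tedges -> 0 <= cost e
}.

(** * Temporal paths *)

Definition follows (R : realType) n (e f : tedge R n) : bool :=
  (dst e == src f) && (avail e + trav e <= avail f)%N.

(* A path has at least one edge, so that its starting time makes sense; since
   the visited vertices [u :: map dst P] are distinct, there is no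
   (u,u)-path. *)
Definition is_tpath (R : realType) (G : tgraph R) (u v : 'I_(nvert G))
    (P : seq (tedge R (nvert G))) : bool :=
  if P is e :: p then
    [&& all (mem (tedges G)) P, src e == u, dst (last e p) == v,
        path (@follows R _) e p & uniq (u :: map (@dst R _) P)]
  else false.

Definition start_time (R : realType) n (P : seq (tedge R n)) : nat :=
  if P is e :: _ then avail e else 0%N.

Definition arrival_time (R : realType) n (P : seq (tedge R n)) : nat :=
  if P is e :: p then (avail (last e p) + trav (last e p))%N else 0%N.

(* The subtraction never truncates on a temporal path. *)
Definition duration (R : realType) n (P : seq (tedge R n)) : nat :=
  (arrival_time P - start_time P)%N.

Definition path_cost (R : realType) n (P : seq (tedge R n)) : R :=
  \sum_(e <- P) cost e.

Definition efficient (R : realType) (G : tgraph R) (s z : 'I_(nvert G))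
    (P : seq (tedge R (nvert G))) : Prop :=
  is_tpath s z P /\
  ~ exists Q, is_tpath s z Q /\
      ((path_cost Q < path_cost P /\ (duration Q <= duration P)%N) \/
       (path_cost Q <= path_cost P /\ (duration Q < duration P)%N)).

(** * The machine model

   A random access machine with a read-only input, a write-only output, a
   work memory of natural numbers and a work memory of costs.  Costs are real
   numbers on which the machine can only perform additions and comparisons.
   Programs are structured commands and contain no real constant but 0. *)

Inductive nexpr :=
| NConst of nat
| NInput of nexpr                (* input word at an address *)
| NLoad of nexpr                 (* work word at an address *)
| NAdd of nexpr & nexpr
| NSub of nexpr & nexpr          (* truncated subtraction *)
| NMul of nexpr & nexpr.

Inductive cexpr :=
| CZero
| CInput of nexpr
| CLoad of nexpr
| CAdd of cexpr & cexpr.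

Inductive bexpr :=
| BLe of nexpr & nexpr
| BCLe of cexpr & cexpr
| BNot of bexpr
| BAnd of bexpr & bexpr.

Inductive cmd :=
| Skip
| NStore of nexpr & nexpr        (* address, value *)
| CStore of nexpr & cexpr        (* address, value *)
| Emit of nexpr                  (* write a word of the current solution *)
| Flush                          (* the current solution is complete *)
| Seq of cmd & cmd
| If of bexpr & cmd & cmd
| While of bexpr & cmd.

Record input (R : realType) := Input { words : seq nat; costs : seq R }.

(* A cost cell carries its value together with a weight, invisible to the
   program: the number of input costs (with multiplicity) summed up in it.
   The weight is only used to charge for space, see [space] below. *)
Record state (R : realType) := State {
  nmem : seq nat;
  cmem : seq (R * nat);
  pending : seq nat;
  outputs : seq (seq nat)
}.

(* Reading outside of the input or of the written memory yields 0. *)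
Fixpoint neval (R : realType) (x : input R) (m : state R) (a : nexpr) : nat :=
  match a with
  | NConst k => k
  | NInput a => nth 0%N (words x) (neval x m a)
  | NLoad a => nth 0%N (nmem m) (neval x m a)
  | NAdd a b => (neval x m a + neval x m b)%N
  | NSub a b => (neval x m a - neval x m b)%N
  | NMul a b => (neval x m a * neval x m b)%N
  end.

Fixpoint ceval (R : realType) (x : input R) (m : state R) (a : cexpr) :
    R * nat :=
  match a with
  | CZero => (0, 0%N)
  | CInput a => (nth 0 (costs x) (neval x m a), 1%N)
  | CLoad a => nth (0, 0%N) (cmem m) (neval x m a)
  | CAdd a b =>
      ((ceval x m a).1 + (ceval x m b).1, ((ceval x m a).2 + (ceval x m b).2)%N)
  end.

Fixpoint beval (R : realType) (x : input R) (m : state R) (b : bexpr) : bool :=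
  match b with
  | BLe a b => (neval x m a <= neval x m b)%N
  | BCLe a b => (ceval x m a).1 <= (ceval x m b).1
  | BNot b => ~~ beval x m b
  | BAnd b c => beval x m b && beval x m c
  end.

(* A configuration is the stack of commands still to be executed, whose height
   is bounded in terms of the program alone, and a state.  The machine has
   halted when the stack is empty. *)
Definition config (R : realType) : Type := (seq cmd * state R)%type.

Definition step (R : realType) (x : input R) (g : config R) : config R :=
  let: (k, m) := g in
  match k with
  | [::] => g
  | Skip :: k => (k, m)
  | NStore a b :: k =>
      (k, State (set_nth 0%N (nmem m) (neval x m a) (neval x m b))
                (cmem m) (pending m) (outputs m))
  | CStore a b :: k =>
      (k, State (nmem m)
                (set_nth (0, 0%N) (cmem m) (neval x m a) (ceval x m b))
                (pending m) (outputs m))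
  | Emit a :: k =>
      (k, State (nmem m) (cmem m) (rcons (pending m) (neval x m a))
                (outputs m))
  | Flush :: k =>
      (k, State (nmem m) (cmem m) [::] (rcons (outputs m) (pending m)))
  | Seq c d :: k => (c :: d :: k, m)
  | If b c d :: k => ((if beval x m b then c else d) :: k, m)
  | While b c :: k => (if beval x m b then c :: While b c :: k else k, m)
  end.

Definition run (R : realType) (p : cmd) (x : input R) (t : nat) : config R :=
  iter t (step x) ([:: p], State [::] [::] [::] [::]).

Definition halted (R : realType) (g : config R) : bool := nilp g.1.

Definition bits (k : nat) : nat := (trunc_log 2 k).+1.

(* Space is the size of the work memory, up to the highest address written,
   measured in bits, so that no unbounded amount of information can be hidden
   in a single cell, and so that counting one time unit per step is
   polynomially equivalent to charging for the length of the operands.  A cost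
   cell of weight w holds a sum of input costs with natural coefficients of
   total w, and is charged the length of w. *)
Definition space (R : realType) (g : config R) : nat :=
  (\sum_(k <- nmem g.2) bits k + \sum_(c <- cmem g.2) bits c.2)%N.

(* The t-th step, t > 0, completes the output of a solution. *)
Definition outputs_at (R : realType) (p : cmd) (x : input R) (t : nat) : bool :=
  (size (outputs (run p x t.-1).2) < size (outputs (run p x t).2))%N.

(** * Enumeration problems and PSDelayP *)

Record enum_problem (R : realType) := EnumProblem {
  instance : Type;
  encode : instance -> input R;
  isize : instance -> nat;
  solution : instance -> seq nat -> Prop   (* encoded solutions *)
}.

Definition restrict (R : realType) (Pi : enum_problem R)
    (A : instance Pi -> Prop) : enum_problem R :=
  @EnumProblem R {x : instance Pi | A x}
    (fun x => encode (sval x)) (fun x => isize (sval x))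
    (fun x => solution (sval x)).

(* Every solution is output exactly once, and nothing else is. *)
Definition enumerates (R : realType) (Pi : enum_problem R) (p : cmd)
    (x : instance Pi) : Prop :=
  exists T, [/\ halted (run p (encode x) T),
    uniq (outputs (run p (encode x) T).2) &
    forall w, w \in outputs (run p (encode x) T).2 <-> solution x w].

(* From the beginning, and from each output, at most D steps elapse until the
   next output or, if there is none, until the machine halts. *)
Definition delay_le (R : realType) (p : cmd) (x : input R) (D : nat) : Prop :=
  forall t, (t == 0%N) || outputs_at p x t ->
  exists2 t', (t < t' <= t + D)%N & outputs_at p x t' || halted (run p x t').

Definition space_le (R : realType) (p : cmd) (x : input R) (S : nat) : Prop :=
  forall t, (space (run p x t) <= S)%N.

Definition PSDelayP (R : realType) (Pi : enum_problem R) : Prop :=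
  exists (p : cmd) (D S : {poly nat}), forall x : instance Pi,
    [/\ enumerates p x,
        delay_le p (encode x) D.[isize x] &
        space_le p (encode x) S.[isize x]].

(** * The enumeration of efficient paths *)

Record mcf_instance (R : realType) := McfInstance {
  mgraph : tgraph R;
  msource : 'I_(nvert mgraph);
  mtarget : 'I_(nvert mgraph)
}.

Definition mcf_encode (R : realType) (x : mcf_instance R) : input R :=
  Input
    ([:: nvert (mgraph x); size (tedges (mgraph x));
         val (msource x); val (mtarget x)]
     ++ flatten [seq [:: val (src e); val (dst e); avail e; trav e]
                | e <- tedges (mgraph x)])
    [seq cost e | e <- tedges (mgraph x)].

(* Natural numbers count by their binary length, each real cost counts 1. *)
Definition mcf_size (R : realType) (x : mcf_instance R) : nat :=
  (nvert (mgraph x) + \sum_(k <- words (mcf_encode x)) bits k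
   + size (costs (mcf_encode x)))%N.

(* A path is output as the sequence of the positions of its edges in the
   input. *)
Definition McfEnum (R : realType) : enum_problem R :=
  @EnumProblem R (mcf_instance R) (@mcf_encode R) (@mcf_size R)
    (fun x w => exists2 P, efficient (msource x) (mtarget x) P &
       w = [seq index e (tedges (mgraph x)) | e <- P]).

Definition McfEnum_cpos (R : realType) : enum_problem R :=
  @restrict R (McfEnum R) (fun x : mcf_instance R =>
    forall e, e \in tedges (mgraph x) -> 0 < cost e).

(* Main.v *)
From mathcomp Require Import all_boot all_order all_algebra.
From mathcomp Require Import reals.
From mathcomp Require Import zify.
Require Import Defs.

Set Implicit Arguments.
Unset Strict Implicit.
Unset Printing Implicit Defensive.
Import Order.TTheory GRing.Theory Num.Theory.
Local Open Scope ring_scope.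

(** Since costs are positive, cutting a cycle out of a walk from s to z <> s makes
it strictly cheaper and no longer in duration, so the efficient paths are the
walks that no walk dominates. Let W(i, j) be the least cost of a walk with first
edge i and last edge j, computed by Bellman-Ford. The start and arrival times of
a walk depend only on its first and last edges, so a walk is undominated iff no
finite W(i, j), with i leaving s and j entering z, dominates it. A prefix u
followed by an edge i extends to a solution iff, for some last edge j entering z,
the cost c(u) + W(i, j) together with the duration from the first edge to j is
undominated. This polynomial test prunes a depth-first search over edge
sequences, which therefore meets no dead ends: between two outputs it backtracks
and then descends, in polynomially many steps. The memory holds only the table W,
the current prefix and its partial costs. *)

(** * Weakest preconditions with time and space bounds *)

Definition rd (R : realType) (m : state R) (a : nat) : nat := nth 0%N (nmem m) a.
Definition crd (R : realType) (m : state R) (a : nat) : R * nat :=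
  nth (0, 0%N) (cmem m) a.
Definition upd (R : realType) (m : state R) (a v : nat) : state R :=
  State (set_nth 0%N (nmem m) a v) (cmem m) (pending m) (outputs m).
Definition cupd (R : realType) (m : state R) (a : nat) (v : R * nat) : state R :=
  State (nmem m) (set_nth (0, 0%N) (cmem m) a v) (pending m) (outputs m).
Definition emit (R : realType) (m : state R) (v : nat) : state R :=
  State (nmem m) (cmem m) (rcons (pending m) v) (outputs m).
Definition flush (R : realType) (m : state R) : state R :=
  State (nmem m) (cmem m) [::] (rcons (outputs m) (pending m)).
Definition init_state (R : realType) : state R := State [::] [::] [::] [::].

Lemma rd_upd (R : realType) (m : state R) a v b :
  rd (upd m a v) b = if b == a then v else rd m b.
Proof. by rewrite /rd /= nth_set_nth. Qed.

Lemma crd_cupd (R : realType) (m : state R) a v b :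
  crd (cupd m a v) b = if b == a then v else crd m b.
Proof. by rewrite /crd /= nth_set_nth. Qed.

(* An upper bound on the running time of a command each of whose loops makes
   at most [N] iterations. *)
Fixpoint time_bound (N : nat) (c : cmd) : nat :=
  match c with
  | Seq c d => (time_bound N c + time_bound N d).+1
  | If _ c d => (time_bound N c + time_bound N d).+1
  | While _ c => (N * (time_bound N c).+1).+1
  | _ => 1
  end%N.

Definition good (R : realType) (S : nat) (m : state R) : bool :=
  [&& size (nmem m) <= S, all (leq^~ S) (nmem m), size (cmem m) <= S
    & all (fun c => c.2 <= S) (cmem m)]%N.

Lemma all_set_nth (T : Type) (a : pred T) x0 s n y :
  a x0 -> a y -> all a s -> all a (set_nth x0 s n y).
Proof.
move=> a0 ay; elim: s n => [|h s IH] [|n] //=; first by rewrite ay.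
- by rewrite a0 /=; elim: n => //= [|n ->]; rewrite ?a0 ?ay.
- by move=> /andP[_ ->]; rewrite ay.
- by move=> /andP[-> /IH ->].
Qed.

Lemma good_upd (R : realType) S (m : state R) a v :
  (a < S)%N -> (v <= S)%N -> good S m -> good S (upd m a v).
Proof.
move=> aS vS /and4P[? ? ? ?]; apply/and4P; split => //=.
  by rewrite size_set_nth geq_max aS.
exact: all_set_nth.
Qed.

Lemma good_cupd (R : realType) S (m : state R) a v :
  (a < S)%N -> (v.2 <= S)%N -> good S m -> good S (cupd m a v).
Proof.
move=> aS vS /and4P[? ? ? ?]; apply/and4P; split => //=.
  by rewrite size_set_nth geq_max aS.
exact: all_set_nth.
Qed.

Lemma bits_le k : (bits k <= k.+1)%N.
Proof.
rewrite /bits ltnS; case: k => [|k]; first by rewrite trunc_log0.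
by apply: (leq_trans (ltnW (ltn_expl _ (ltnSn 1)))); exact: trunc_logP.
Qed.

Lemma sum_bits_le (T : Type) (f : T -> nat) S (s : seq T) :
  (size s <= S)%N -> all (fun c => f c <= S)%N s ->
  (\sum_(c <- s) bits (f c) <= S * S.+1)%N.
Proof.
move=> sS aS; apply: (@leq_trans (size s * S.+1)); last by rewrite leq_mul2r sS orbT.
elim: s {sS} aS => [|c s IH] /=; first by rewrite big_nil.
move=> /andP[cS /IH sS]; rewrite big_cons mulSn leq_add //.
exact: leq_trans (bits_le _) _.
Qed.

Lemma good_space (R : realType) S (g : config R) :
  good S g.2 -> (space g <= (S * S.+1).*2)%N.
Proof.
move=> /and4P[? ? ? ?]; rewrite /space -addnn.
apply: leq_add; [exact: (@sum_bits_le _ id) | exact: (@sum_bits_le _ snd)].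
Qed.

Definition var (a : nat) : nexpr := NLoad (NConst a).
Definition blt (a b : nexpr) : bexpr := BNot (BLe b a).

Definition For (v : nat) (body : cmd) : cmd :=
  Seq (NStore (NConst v) (NConst 0))
    (While (blt (var v) (NInput (NConst 1)))
      (Seq body (NStore (NConst v) (NAdd (var v) (NConst 1))))).

Section WeakestPrecondition.
Variables (R : realType) (x : input R) (N S : nat).
Implicit Types (m : state R) (Q : state R -> Prop).

Definition quiet (g : config R) (t : nat) : Prop := forall u, (u <= t)%N ->
  good S (iter u (step x) g).2 /\ outputs (iter u (step x) g).2 = outputs g.2.

Lemma quietD g g1 t1 t2 : quiet g t1 -> iter t1 (step x) g = g1 ->
  quiet g1 t2 -> quiet g (t1 + t2).
Proof.
move=> q1 e1 q2 u ut; case: (leqP u t1) => [/q1//|t1u].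
have -> : u = (u - t1 + t1)%N by rewrite subnK // ltnW.
rewrite iterD e1; have [|? ->] := q2 (u - t1)%N; first by rewrite leq_subLR.
by split=> //; have [] := q1 t1 (leqnn _); rewrite e1.
Qed.

Lemma quiet1 g : good S g.2 -> good S (step x g).2 ->
  outputs (step x g).2 = outputs g.2 -> quiet g 1.
Proof. by move=> ? ? ? [|[|u]]. Qed.

Definition wp (c : cmd) Q m : Prop := good S m -> exists t m',
  [/\ (t <= time_bound N c)%N,
      forall k, iter t (step x) (c :: k, m) = (k, m'),
      forall k, quiet (c :: k, m) t & Q m'].

Lemma wp_mono c Q Q' m : (forall m', Q m' -> Q' m') -> wp c Q m -> wp c Q' m.
Proof. by move=> QQ H /H[t [m' [? ? ? /QQ ?]]]; exists t, m'. Qed.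

Lemma quiet_end c k m t m' : iter t (step x) (c :: k, m) = (k, m') ->
  quiet (c :: k, m) t -> good S m' /\ outputs m' = outputs m.
Proof. by move=> e /(_ t (leqnn _)); rewrite e. Qed.

Lemma wp_outputs c Q m :
  wp c Q m -> wp c (fun m' => Q m' /\ outputs m' = outputs m) m.
Proof.
move=> H /H[t [m' [? e q ?]]]; exists t, m'; split=> //; split=> //.
by have [] := quiet_end (e [::]) (q _).
Qed.

Lemma wp1 c Q m m' : (0 < time_bound N c)%N ->
    (forall k, step x (c :: k, m) = (k, m')) ->
    (good S m -> good S m') -> outputs m' = outputs m -> Q m' ->
  wp c Q m.
Proof.
move=> c0 e g o q gm; exists 1%N, m'; split=> //= k.
by apply: quiet1; rewrite ?e //=; exact: g.
Qed.

Lemma wp_skip Q m : Q m -> wp Skip Q m.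
Proof. by move=> ?; apply: wp1. Qed.

Lemma wp_nstore a b Q m : (neval x m a < S)%N -> (neval x m b <= S)%N ->
  Q (upd m (neval x m a) (neval x m b)) -> wp (NStore a b) Q m.
Proof. by move=> ? ?; apply: wp1 => //; exact: good_upd. Qed.

Lemma wp_cstore a b Q m : (neval x m a < S)%N -> ((ceval x m b).2 <= S)%N ->
  Q (cupd m (neval x m a) (ceval x m b)) -> wp (CStore a b) Q m.
Proof. by move=> ? ?; apply: wp1 => //; exact: good_cupd. Qed.

Lemma wp_emit a Q m : Q (emit m (neval x m a)) -> wp (Emit a) Q m.
Proof. exact: wp1. Qed.

Lemma wp_seq c d Q m : wp c (wp d Q) m -> wp (Seq c d) Q m.
Proof.
move=> H gm; have [t1 [m1 [T1 e1 q1 H1]]] := H gm.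
have [gm1 _] := quiet_end (e1 [::]) (q1 _).
have [t2 [m2 [T2 e2 q2 H2]]] := H1 gm1.
exists (t2 + t1).+1, m2; split=> //=.
- by rewrite ltnS addnC leq_add.
- by move=> k; rewrite -iterS iterSr iterD /= e1 e2.
move=> k; rewrite -addn1 addnC; apply: quietD.
- exact: quiet1.
- by [].
- by rewrite addnC; apply: quietD; [exact: q1| exact: e1| exact: q2].
Qed.

Lemma wp_if b c d Q m : (beval x m b -> wp c Q m) ->
  (~~ beval x m b -> wp d Q m) -> wp (If b c d) Q m.
Proof.
move=> Hc Hd gm.
have [t [m' [T e q H]]] : exists t m',
  [/\ (t <= time_bound N c + time_bound N d)%N,
    forall k, iter t (step x) ((if beval x m b then c else d) :: k, m) = (k, m'),
    forall k, quiet ((if beval x m b then c else d) :: k, m) t & Q m'].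
  case: (boolP (beval x m b)) => [/Hc|/Hd] /(_ gm) [t [m' [T e q H]]];
    exists t, m'; split=> //; apply: (leq_trans T).
  - exact: leq_addr.
  - exact: leq_addl.
exists t.+1, m'; split=> //=.
- by move=> k; rewrite -iterS iterSr /= e.
- by move=> k; rewrite -add1n; apply: quietD (q k) => //; exact: quiet1.
Qed.

Lemma wp_while b c (I : nat -> state R -> Prop) Q m :
    (forall i m, I i m -> beval x m b -> (i < N)%N /\ wp c (I i.+1) m) ->
    (forall i m, I i m -> ~~ beval x m b -> Q m) ->
  I 0 m -> wp (While b c) Q m.
Proof.
move=> Hc HQ.
suff: forall n i m, (i + n = N)%N -> I i m -> good S m -> exists t m',
   [/\ (t <= (n * (time_bound N c).+1).+1)%N,
      forall k, iter t (step x) (While b c :: k, m) = (k, m'),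
      forall k, quiet (While b c :: k, m) t & Q m'].
  by move=> H I0 gm; exact: (H N 0%N m).
elim=> [|n IH] i {}m e Ii gm.
all: case: (boolP (beval x m b)) => hb; last first.
- exists 1%N, m; split=> //= [k|k|].
  + by rewrite (negbTE hb).
  + by apply: quiet1; rewrite //= (negbTE hb).
  + exact: HQ Ii hb.
- by have [] := Hc _ _ Ii hb; rewrite -e addn0 ltnn.
- exists 1%N, m; split=> //= [k|k|].
  + by rewrite (negbTE hb).
  + by apply: quiet1; rewrite //= (negbTE hb).
  + exact: HQ Ii hb.
have [_ H1] := Hc _ _ Ii hb.
have [t1 [m1 [T1 e1 q1 I1]]] := H1 gm.
have [gm1 _] := quiet_end (e1 [::]) (q1 _).
have [|t2 [m2 [T2 e2 q2 H2]]] := IH i.+1 m1 _ I1 gm1; first by rewrite addSnnS.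
exists (t2 + t1).+1, m2; split=> //.
- by rewrite ltnS mulSn addSn -addnS addnC leq_add.
- by move=> k; rewrite iterSr /= hb iterD e1 e2.
- move=> k; rewrite -add1n; apply: quietD.
  + by apply: quiet1; rewrite //= hb.
  + by rewrite /= hb.
  + by rewrite addnC; apply: quietD; [exact: q1| exact: e1| exact: q2].
Qed.

Lemma wp_for v body (I : nat -> state R -> Prop) Q m :
    N = nth 0%N (words x) 1 -> (v < S)%N -> (N <= S)%N ->
    I 0%N (upd m v 0) ->
    (forall i m, (i < N)%N -> rd m v = i -> I i m ->
       wp body (fun m' => rd m' v = i /\ I i.+1 (upd m' v i.+1)) m) ->
    (forall m, I N m -> Q m) ->
  wp (For v body) Q m.
Proof.
move=> eN vS NS I0 Hb HQ; apply: wp_seq; apply: wp_nstore => //=.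
apply: (@wp_while _ _ (fun i m => [/\ (i <= N)%N, rd m v = i & I i m])).
- move=> i m1 [iN rv Ii] /=; rewrite -ltnNge -eN -[nth _ _ v]/(rd m1 v) rv.
  move=> ltiN; split=> //; apply: wp_seq; apply: wp_mono (Hb _ _ ltiN rv Ii).
  move=> m' [rv' I']; apply: wp_nstore => //=.
  + by rewrite -[nth _ _ v]/(rd m' v) rv' addn1; exact: leq_trans NS.
  + by rewrite -[nth _ _ v]/(rd m' v) rv' addn1; split; rewrite // rd_upd eqxx.
- move=> i m1 [iN rv Ii] /=; rewrite negbK -eN -[nth _ _ v]/(rd m1 v) rv => Ni.
  by apply: HQ; rewrite (_ : N = i) //; apply/eqP; rewrite eqn_leq Ni.
- by split=> //; rewrite rd_upd eqxx.
Qed.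

End WeakestPrecondition.

Section EnumerationLoop.
Variables (R : realType) (x : input R) (N S : nat) (A B E : cmd) (b d : bexpr).
Variables (J : nat -> state R -> Prop) (U F : nat).

Definition enum_loop : cmd := While b (Seq B (If d (Seq E Flush) Skip)).
Let Tb : nat := (time_bound N B + time_bound N E + 6)%N.
Let J' (m : state R) := exists2 u, (u <= U)%N & J u m.
Hypothesis J_init : wp x N S A J' (init_state R).
Hypothesis J_step : forall u m, J u m -> beval x m b ->
  wp x N S B (fun m1 => if beval x m1 d
    then wp x N S E (fun m2 => J' (flush m2)) m1
    else exists2 u', (u' < u)%N & J u' m1) m.
Hypothesis J_outputs : forall u m, J u m -> (size (outputs m) <= F)%N.

Let P := Seq A enum_loop.
Let loop_head t u (m : state R) :=
  [/\ run P x t = ([:: enum_loop], m), J u m & good S m].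
Let stopped t (m : state R) :=
  [/\ run P x t = ([::], m), exists u, J u m, ~~ beval x m b & good S m].

Lemma runD t u : run P x (t + u) = iter u (step x) (run P x t).
Proof. by rewrite /run addnC iterD. Qed.

Lemma quiet_run t n u : quiet x S (run P x t) n -> (t < u <= t + n)%N ->
  good S (run P x u).2 /\ ~~ outputs_at P x u.
Proof.
move=> q /andP[tu un].
have [|g o] := q (u - t)%N; first by lia.
have [|_ o'] := q (u - t).-1; first by lia.
rewrite -runD in g o; rewrite -runD in o'.
have e : (t + (u - t) = u)%N by lia.
have e' : (t + (u - t).-1 = u.-1)%N by lia.
by rewrite e in g o; rewrite e' in o'; rewrite /outputs_at g o o' ltnn.
Qed.

Lemma segment t u m : loop_head t u m -> exists2 n, (0 < n <= Tb)%N &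
  (forall v, (t < v < t + n)%N -> good S (run P x v).2 /\ ~~ outputs_at P x v)
  /\ ((exists m', stopped (t + n) m' /\ ~~ outputs_at P x (t + n)) \/
   (exists u' m', [/\ loop_head (t + n) u' m',
      outputs_at P x (t + n) -> size (outputs m') = (size (outputs m)).+1
          /\ (u' <= U)%N
      & ~~ outputs_at P x (t + n) -> (u' < u)%N /\ outputs m' = outputs m])).
Proof.
move=> [e Ju gm].
have [hb|hb] := boolP (beval x m b); last first.
  exists 1%N; first by rewrite /Tb; lia.
  split; first by move=> v; lia.
  have e1 : run P x (t + 1) = ([::], m) by rewrite runD e /= (negbTE hb).
  left; exists m; split; first by split=> //; exists u.
  by rewrite /outputs_at e1 (_ : (t + 1).-1 = t)%N ?e ?ltnn //; lia.
have [t1 [m1 [T1 e1 q1 H1]]] := J_step Ju hb gm.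
have [gm1 o1] := quiet_end (e1 [::]) (q1 _).
set K := If d (Seq E Flush) Skip; set W := enum_loop.
have s1 : run P x (t + (t1 + 2)) = ([:: K; W], m1).
  by rewrite runD e addn2 !iterSr /= hb /= e1.
have Q1 : quiet x S (run P x t) (t1 + 2).
  rewrite e (_ : t1 + 2 = (1 + 1) + t1)%N; last by lia.
  apply: (@quietD _ _ _ _ ([:: B; K; W], m)).
  - apply: (@quietD _ _ _ _ ([:: Seq B K; W], m)).
    + by apply: quiet1; rewrite //= hb.
    + by rewrite /= hb.
    + exact: quiet1.
  - by rewrite /= hb.
  - exact: q1.
have [hd|hd] := boolP (beval x m1 d); last first.
  rewrite (negbTE hd) in H1; have [u' uu' Ju'] := H1.
  have s2 : run P x (t + (t1 + 4)) = ([:: W], m1).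
    rewrite (_ : t + (t1 + 4) = t + (t1 + 2) + 2)%N; last by lia.
    by rewrite runD s1 /= (negbTE hd).
  have Q2 : quiet x S (run P x t) (t1 + 4).
    rewrite (_ : t1 + 4 = t1 + 2 + 2)%N; last by lia.
    apply: quietD; [exact: Q1| by rewrite -runD; exact: s1|].
    move=> [|[|[|]]] //=; by rewrite ?(negbTE hd).
  exists (t1 + 4)%N; first by rewrite /Tb; lia.
  split; first by move=> v hv; apply: quiet_run Q2 _; lia.
  have no : ~~ outputs_at P x (t + (t1 + 4)).
    by have [] := @quiet_run _ _ (t + (t1 + 4)) Q2; first by lia.
  by right; exists u', m1; split=> //; rewrite (negbTE no).
rewrite hd in H1.
have [t2 [m2 [T2 e2 q2 [u' uU Ju']]]] := H1 gm1.
have [gm2 o2] := quiet_end (e2 [::]) (q2 _).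
have Q2 : quiet x S (run P x t) (t1 + 2 + (2 + t2)).
  apply: quietD; [exact: Q1| by rewrite -runD; exact: s1|].
  apply: (@quietD _ _ _ _ ([:: E; Flush; W], m1)).
  - by move=> [|[|[|]]] //=; rewrite ?hd.
  - by rewrite /= hd.
  - exact: q2.
have s2 : run P x (t + (t1 + 2 + (2 + t2))) = ([:: Flush; W], m2).
  by rewrite addnA runD s1 addnC iterD /= hd e2.
have s3 : run P x (t + (t1 + t2 + 5)) = ([:: W], flush m2).
  rewrite (_ : t + (t1 + t2 + 5) = t + (t1 + 2 + (2 + t2)) + 1)%N; last by lia.
  by rewrite runD s2.
exists (t1 + t2 + 5)%N; first by rewrite /Tb; lia.
split; first by move=> v hv; apply: quiet_run Q2 _; lia.
have oa : outputs_at P x (t + (t1 + t2 + 5)).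
  rewrite /outputs_at s3 (_ : (t + (t1 + t2 + 5)).-1 = t + (t1 + 2 + (2 + t2)))%N;
    last by lia.
  rewrite s2 /=.
  by rewrite size_rcons.
right; exists u', (flush m2); split=> //.
- by move=> _; rewrite /= size_rcons o2 o1.
- by rewrite oa.
Qed.

Lemma next_event u t m : loop_head t u m ->
  exists2 t', (t < t' <= t + u.+1 * Tb)%N &
  (forall v, (t < v < t')%N -> good S (run P x v).2 /\ ~~ outputs_at P x v)
  /\ ((exists m', stopped t' m' /\ ~~ outputs_at P x t') \/
   (exists u' m', [/\ loop_head t' u' m', outputs_at P x t', (u' <= U)%N
      & size (outputs m') = (size (outputs m)).+1])).
Proof.
have [n] := ubnP u; elim: n => // n IH in u t m * => un H.
have [k kT [q [st|[u' [m' [lh oy on]]]]]] := segment H.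
  by exists (t + k)%N; [rewrite mulSn; lia|split=> //; left].
have [o|o] := boolP (outputs_at P x (t + k)).
  have [so uU] := oy o.
  exists (t + k)%N; first by rewrite mulSn; lia.
  by split=> //; right; exists u', m'.
have [uu so] := on o.
have [|t' tt' [q' H']] := IH u' _ _ _ lh; first by lia.
have le : (u'.+1 * Tb <= u * Tb)%N by rewrite leq_mul2r uu orbT.
exists t'; first by rewrite mulSn; lia.
split; last by rewrite so in H'.
have [[_ _ g]] := lh; move=> v hv.
case: (ltngtP v (t + k)%N) => hv'.
- by apply: q; lia.
- by apply: q'; lia.
- by rewrite hv' o (let: And3 e _ _ := lh in e).
Qed.

Lemma stopped_later t m v : stopped t m -> (t <= v)%N -> run P x v = ([::], m).
Proof.
move=> [e _ _ _] tv; rewrite -(subnKC tv) runD e.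
by elim: (v - t)%N => //= n ->.
Qed.

Lemma enum_loop_tail t u m : (u <= U)%N -> loop_head t u m ->
  [/\ exists T m', stopped T m',
      forall v, (t < v)%N -> good S (run P x v).2 &
      forall v, (t < v)%N -> outputs_at P x v ->
        exists u' m', (u' <= U)%N /\ loop_head v u' m'].
Proof.
have [n] := ubnP (F - size (outputs m))%N.
elim: n => // n IH in t u m * => sn uU lh.
have [t' tt' [q [[m' [st no]]|[u' [m' [lh' o uU' so]]]]]] := next_event lh.
  split; first by exists t', m'.
  - move=> v tv; case: (ltnP v t') => [vt|]; first by have [] := q v; first lia.
    by move=> /(stopped_later st) ->; have [] := st.
  - move=> v tv ov; case: (ltngtP v t') => [vt|vt|vt].
    + by have [|_] := q v; [lia|rewrite ov].
    + move: ov; rewrite /outputs_at !(stopped_later st) ?ltnn //; lia.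
    + by move: ov; rewrite vt (negbTE no).
have F' := J_outputs (let: And3 _ j _ := lh' in j).
have [|T g H] := IH _ _ _ _ uU' lh'; first by lia.
split=> // v tv; case: (ltngtP v t') => [vt|vt|->].
- by have [] := q v; first lia.
- exact: g.
- by have [-> _ ?] := lh'.
- by move=> ov; have [|_] := q v; [lia|rewrite ov].
- exact: H.
- by move=> _; exists u', m'.
Qed.

Lemma enum_loopP : (0 < S)%N -> exists D,
  [/\ (D <= time_bound N A + U.+1 * Tb + 1)%N,
      exists T m u, [/\ run P x T = ([::], m), J u m & ~~ beval x m b],
      forall t, good S (run P x t).2 & delay_le P x D].
Proof.
move=> S0.
have g0 : good S (init_state R) by [].
have [t1 [m1 [T1 e1 q1 [u uU Ju]]]] := J_init g0.
have [gm1 o1] := quiet_end (e1 [::]) (q1 _).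
have Q : quiet x S (run P x 0) (t1 + 1).
  rewrite addnC; apply: (@quietD _ _ _ _ ([:: A; enum_loop], init_state R)) => //.
  exact: quiet1.
have lh : loop_head (t1 + 1)%N u m1.
  by split=> //; rewrite -[(t1 + 1)%N]add0n runD addn1 iterSr /= e1.
have [[T [m st]] G H] := enum_loop_tail uU lh.
exists (t1 + 1 + U.+1 * Tb)%N; split.
- by lia.
- by exists T, m; have [? [u' ?] ? ?] := st; exists u'.
- move=> t; case: (leqP t (t1 + 1)) => [/Q[]//|/G//].
move=> t ht.
have [t0|[u' [m' [uU' lh']]]] :
    t = 0%N \/ exists u' m', (u' <= U)%N /\ loop_head t u' m'.
  case/orP: ht => [/eqP->|ot]; first by left.
  case: (posnP t) => [->|t0]; first by left.
  right; case: (ltnP (t1 + 1) t) => [tt|tt]; first exact: H.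
  by have [|_] := quiet_run (u := t) Q; [lia|rewrite ot].
- have [t' tt' [_ ev]] := next_event lh; exists t'.
    have : (u.+1 * Tb <= U.+1 * Tb)%N by rewrite leq_mul2r ltnS uU orbT.
    by lia.
  case: ev => [[m' [[e _ _ _] _]]|[? [? [_ -> _ _]]]] //.
  by rewrite /halted e orbT.
- have [t' tt' [_ ev]] := next_event lh'; exists t'.
    have : (u'.+1 * Tb <= U.+1 * Tb)%N by rewrite leq_mul2r ltnS uU' orbT.
    by lia.
  case: ev => [[? [[e _ _ _] _]]|[? [? [_ -> _ _]]]] //.
  by rewrite /halted e orbT.
Qed.

End EnumerationLoop.

(** * Minimum-cost walks and efficient paths *)

Lemma map_not_uniq (T : Type) (U : eqType) (f : T -> U) (v : seq T) :
  ~~ uniq (map f v) ->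
  exists a i b j c, v = a ++ i :: b ++ j :: c /\ f i = f j.
Proof.
elim: v => //= i v IH; rewrite negb_and negbK => /orP[|/IH]; last first.
  by move=> [a [j [b [k [c [-> e]]]]]]; exists (i :: a), j, b, k, c.
suff H : forall x, x \in map f v -> exists b j c, v = b ++ j :: c /\ f j = x.
  by move=> /H [b [j [c [-> e]]]]; exists [::], i, b, j, c.
move=> x; elim: v {IH} => //= j v IH; rewrite inE => /orP[/eqP->|/IH].
  by exists [::], j, v.
by move=> [b [k [c [-> e]]]]; exists (j :: b), k, c.
Qed.

Definition dominates (R : realDomainType) (c c' : R) (d d' : nat) : bool :=
  [&& c <= c', (d <= d')%N & ~~ ((c' <= c) && (d' <= d)%N)].

Lemma dominates_trans (R : realDomainType) (c0 c c' c1 : R) d0 d d' d1 :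
  c0 <= c -> (d0 <= d)%N -> c' <= c1 -> (d' <= d1)%N ->
  dominates c c' d d' -> dominates c0 c1 d0 d1.
Proof.
move=> c0c d0d c'1 d'1 /and3P[cc dd n]; apply/and3P; split.
- exact: le_trans (le_trans cc c'1).
- by lia.
apply: contra n => /andP[h1 h2]; rewrite (le_trans c'1 (le_trans h1 c0c)) /=.
by lia.
Qed.

Lemma dominatesE (R : realDomainType) (c c' : R) d d' :
  dominates c c' d d' <->
  (c < c' /\ (d <= d')%N) \/ (c <= c' /\ (d < d')%N).
Proof.
rewrite /dominates; split.
  move=> /and3P[-> dd]; rewrite negb_and -ltNge -ltnNge => /orP[]; auto.
case=> [[h h']|[h h']].
  by rewrite (ltW h) h' /= leNgt h.
by rewrite h (ltnW h') /= [(d' <= d)%N]leqNgt h' andbF.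
Qed.

Section Walks.
Variables (R : realDomainType) (M s z : nat) (sr ds av tr : nat -> nat).
Variable co : nat -> R.
Implicit Types (i j k : nat) (p q u v : seq nat) (W : nat -> nat -> R).

Definition tfollows i j : bool := (ds i == sr j) && (av i + tr i <= av j)%N.
Definition wcost v : R := \sum_(i <- v) co i.
Definition wdur i j : nat := (av j + tr j - av i)%N.
Definition span v : nat := wdur (head 0%N v) (last 0%N v).
Definition walk v : bool := [&& v != [::], sorted tfollows v & all (gtn M) v].
Definition swalk v : bool := walk v && (sr (head 0%N v) == s).
Definition stwalk v : bool := swalk v && (ds (last 0%N v) == z).
Definition simple v : bool := uniq (s :: map ds v).
Definition efficient_word v : Prop := [/\ stwalk v, simple v &
  forall q, stwalk q -> simple q ->
    ~~ dominates (wcost q) (wcost v) (span q) (span v)].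

Lemma wcost_cons i v : wcost (i :: v) = co i + wcost v.
Proof. exact: big_cons. Qed.

Lemma wcost_cat u v : wcost (u ++ v) = wcost u + wcost v.
Proof. exact: big_cat. Qed.

Lemma wcost_rcons v i : wcost (rcons v i) = wcost v + co i.
Proof. by rewrite -cats1 wcost_cat /wcost big_seq1. Qed.

Lemma tfollows_arrival i p : path tfollows i p ->
  (av i + tr i <= av (last i p) + tr (last i p))%N.
Proof.
elim: p i => //= j p IH i /andP[/andP[_ h] /IH]; lia.
Qed.

Lemma tfollows_start i p j q : path tfollows i (p ++ j :: q) -> (av i <= av j)%N.
Proof.
by elim: p i => [|k p IH] i /= /andP[/andP[_ h]]; [lia|move=> /IH; lia].
Qed.

Lemma sorted_start p j q :
  sorted tfollows (p ++ j :: q) -> (av (head 0%N (p ++ j :: q)) <= av j)%N.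
Proof. by case: p => //= i p; exact: tfollows_start. Qed.

Hypothesis co_gt0 : forall i, (i < M)%N -> 0 < co i.
Hypothesis s_neq_z : s != z.

Lemma wcost_ge0 v : all (gtn M) v -> 0 <= wcost v.
Proof.
elim: v => [|i v IH] /=; first by rewrite /wcost big_nil.
by move=> /andP[/co_gt0 h /IH ?]; rewrite wcost_cons addr_ge0 // ltW.
Qed.

Lemma cut_cycle v : stwalk v -> ~~ simple v -> exists q,
  [/\ stwalk q, wcost q < wcost v, (span q <= span v)%N & (size q < size v)%N].
Proof.
move=> /andP[/andP[/and3P[v0 sv aM] /eqP hs] /eqP hz].
rewrite /simple cons_uniq negb_and negbK; case/orP.
  move=> /mapP[k kv sk]; case/splitPr: kv v0 sv aM hs hz => p1 [|j p] v0 sv aM hs hz.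
    by move: s_neq_z; rewrite sk -hz last_cat /= eqxx.
  move: sv; rewrite sorted_cat_cons => /andP[s1 /= /andP[/andP[/eqP dk tk] pj]].
  move: aM; rewrite all_cat /= => /and4P[a1 ak aj ap].
  exists (j :: p); split.
  - by rewrite /stwalk /swalk /walk /= pj aj ap -dk -sk eqxx /= -hz last_cat /=.
  - rewrite wcost_cat [wcost (k :: _)]wcost_cons addrA ltrDr.
    by rewrite ltr_wpDl ?wcost_ge0 // co_gt0.
  - rewrite /span /wdur last_cat /=; apply: leq_sub => //.
    move: (@sorted_start (rcons p1 k) j p); rewrite cat_rcons; apply.
    by rewrite sorted_cat_cons s1 /= /tfollows dk eqxx tk.
  - by rewrite size_cat /=; lia.
move=> /map_not_uniq[a [i [b [j [c [ev eij]]]]]]; subst v.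
move: sv; rewrite sorted_cat_cons => /andP[s1].
rewrite cat_path => /andP[pb /= /andP[fj pc]].
move: aM; rewrite all_cat /= all_cat /= => /and5P[aa ai ab aj ac].
have arr : (av i + tr i <= av j + tr j)%N.
  have := @tfollows_arrival i (rcons b j).
  by rewrite rcons_path pb fj last_rcons; apply.
have hd : head 0%N (a ++ i :: c) = head 0%N (a ++ i :: b ++ j :: c) by case: (a).
exists (a ++ i :: c); split.
- rewrite /stwalk /swalk hd hs eqxx /walk all_cat /= aa ai ac.
  rewrite sorted_cat_cons s1 !andbT -hz !last_cat /= last_cat /=.
  rewrite (_ : _ != [::]); last by case: (a).
  case: (c) pc => [|k c'] /=; first by rewrite eij eqxx.
  by rewrite /tfollows eij => /andP[/andP[-> h] ->]; rewrite eqxx !andbT; lia.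
- rewrite !(wcost_cat, wcost_cons) ltrD2l ltrD2l.
  by rewrite addrA ltrDr ltr_wpDl ?wcost_ge0 // co_gt0.
- rewrite /span /wdur hd; apply: leq_sub => //; rewrite !last_cat /= last_cat /=.
  by case: (c).
- by rewrite size_cat /= size_cat /= size_cat /=; lia.
Qed.

Lemma simple_shortcut v : stwalk v -> exists q,
  [/\ stwalk q, simple q, wcost q <= wcost v, (span q <= span v)%N &
    ~~ simple v -> wcost q < wcost v].
Proof.
have [n] := ubnP (size v); elim: n => // n IH in v * => vn sv.
have [si|nsi] := boolP (simple v); first by exists v.
have [q [sq cq dq zq]] := cut_cycle sv nsi.
have [|p [sp pp cp dp _]] := IH q _ sq; first by lia.
exists p; split=> //; last by move=> _; exact: le_lt_trans cq.
- exact: le_trans (ltW cq).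
- exact: leq_trans dq.
Qed.

Lemma efficient_wordP v : efficient_word v <-> stwalk v /\
  forall q, stwalk q -> ~~ dominates (wcost q) (wcost v) (span q) (span v).
Proof.
split=> [[sv iv H]|[sv H]].
  split=> // q sq; have [p [sp ip cp dp _]] := simple_shortcut sq.
  by apply: contra (H p sp ip); exact: dominates_trans.
have [iv|niv] := boolP (simple v); first by split=> // q sq _; exact: H.
have [q [sq _ cq dq /(_ niv) lt]] := simple_shortcut sv.
by case/negP: (H q sq); apply/dominatesE; left.
Qed.

Lemma efficient_word_size v : efficient_word v -> (size v <= M)%N.
Proof.
move=> [/andP[/andP[/and3P[_ _ aM] _] _] /andP[_ /map_uniq uv] _].
rewrite -(size_iota 0 M); apply: uniq_leq_size => // i iv.
by rewrite mem_iota add0n; exact: (allP aM).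
Qed.

Lemma swalk_prefix u v : u != [::] -> swalk (u ++ v) -> swalk u.
Proof.
move=> u0 /andP[/and3P[_ /cat_sorted2[su _]]]; rewrite all_cat => /andP[au _] hs.
by rewrite /swalk /walk u0 su au; case: u u0 {su au} hs.
Qed.

Lemma swalk_rcons u i : (i < M)%N -> swalk u ->
  swalk (rcons u i) = tfollows (last 0%N u) i.
Proof.
case: u => // j u iM /andP[/and3P[_ /= pu au] hs].
rewrite /swalk /walk /= hs rcons_path [path _ _ _]pu all_rcons /= iM.
by move: au => /= ->; rewrite !andbT.
Qed.

Definition mincost W : Prop := forall i j, (i < M)%N -> (j < M)%N ->
  (0 < W i j -> exists p, [/\ walk (i :: p), last i p = j & wcost (i :: p) = W i j])
  /\ forall p, walk (i :: p) -> last i p = j -> 0 < W i j <= wcost (i :: p).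

Definition undominated W (c : R) (d : nat) : Prop := forall i j,
  (i < M)%N -> (j < M)%N -> sr i = s -> ds j = z -> 0 < W i j ->
  ~~ dominates (W i j) c (wdur i j) d.

Lemma walk_last i p : walk (i :: p) -> (i < M)%N /\ (last i p < M)%N.
Proof.
move=> /and3P[_ _ /allP aM]; split; first by apply: aM; rewrite mem_head.
by apply: aM; exact: mem_last.
Qed.

Lemma undominatedP W c d : mincost W -> undominated W c d <->
  forall q, stwalk q -> ~~ dominates (wcost q) c (span q) d.
Proof.
move=> HW; split=> H.
  case=> // i p /andP[/andP[wq /eqP hs] /eqP hz].
  have [iM jM] := walk_last wq.
  have [_ /(_ _ wq erefl) /andP[W0 Wle]] := HW _ _ iM jM.
  by apply: contra (H _ _ iM jM hs hz W0); apply: dominates_trans.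
move=> i j iM jM hs hz /(HW _ _ iM jM).1 [p [wp lp <-]].
rewrite -lp; apply: (H (i :: p)).
by rewrite /stwalk /swalk wp /= hs lp hz !eqxx.
Qed.

Definition completes W u i j : Prop :=
  [/\ ds j = z, 0 < W i j &
    undominated W (wcost u + W i j) (wdur (head 0%N (rcons u i)) j)].

Lemma extensionP W u i : mincost W -> swalk (rcons u i) ->
  (exists2 j, (j < M)%N & completes W u i j) <->
  (exists v, efficient_word (rcons u i ++ v)).
Proof.
move=> HW sw; have /andP[/and3P[_ su au] hs] := sw.
have iM : (i < M)%N by move: au; rewrite all_rcons => /andP[].
split=> [[j jM [hz W0 /(undominatedP _ _ HW) H]]|[v]].
  have [p [wp lp cp]] := (HW _ _ iM jM).1 W0.
  exists p; rewrite efficient_wordP.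
  have -> : wcost (rcons u i ++ p) = wcost u + W i j.
    by rewrite -cp cat_rcons wcost_cat.
  have -> : span (rcons u i ++ p) = wdur (head 0%N (rcons u i)) j.
    by rewrite /span last_cat last_rcons lp; case: (u).
  split=> //; rewrite /stwalk /swalk last_cat last_rcons lp hz eqxx andbT.
  have -> : head 0%N (rcons u i ++ p) = head 0%N (rcons u i) by case: (u).
  rewrite hs andbT; have /and3P[_ pp ap] := wp; rewrite /walk all_cat au.
  have -> : all (gtn M) p by case/andP: ap.
  rewrite cat_rcons sorted_cat_cons su andbT /=.
  by rewrite [path _ _ _]pp; case: (u).
move=> /efficient_wordP [/andP[/andP[/and3P[_ sv av'] _] /eqP hz] H].
move: hz; rewrite last_cat last_rcons => hz.
have wv : walk (i :: v).
  move: sv av'; rewrite cat_rcons sorted_cat_cons all_cat.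
  by move=> /andP[_ pv] /andP[_ a]; rewrite /walk a andbT.
have [_ jM] := walk_last wv; exists (last i v) => //.
have [_ /(_ _ wv erefl) /andP[W0 Wle]] := HW _ _ iM jM.
split=> //; apply/undominatedP => // q /H; apply: contra.
have -> : span (rcons u i ++ v) = wdur (head 0%N (rcons u i)) (last i v).
  by rewrite /span last_cat last_rcons; case: (u).
apply: dominates_trans => //; by rewrite cat_rcons wcost_cat lerD2l.
Qed.

Lemma mincost_diag W i : mincost W -> (i < M)%N -> W i i = co i.
Proof.
move=> HW iM; have [h1 h2] := HW _ _ iM iM.
have wi : walk [:: i] by rewrite /walk /= iM.
have /andP[W0 Wle] := h2 [::] wi erefl.
have [p [wp _ e]] := h1 W0; apply/eqP; rewrite eq_le -{2}e wcost_cons.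
have /and3P[_ _ /andP[_ ap]] := wp.
by rewrite lerDl wcost_ge0 // andbT; move: Wle; rewrite /wcost big_seq1.
Qed.

Lemma completionP W u i : mincost W -> swalk (rcons u i) ->
  completes W u i i <-> efficient_word (rcons u i).
Proof.
move=> HW sw; have /andP[/and3P[_ su au] hs] := sw.
have iM : (i < M)%N by move: au; rewrite all_rcons => /andP[].
rewrite /completes efficient_wordP /stwalk sw last_rcons (mincost_diag HW iM).
rewrite wcost_rcons /= [span (rcons u i)]/span last_rcons.
split=> [[-> _ /(undominatedP _ _ HW) H]|[/eqP hz H]]; first by rewrite eqxx.
by split=> //; [exact: co_gt0|apply/undominatedP].
Qed.

(* Bellman-Ford: [relaxed n D W] says that [W] accounts for all walks with at
   most [n + 1] edges, and for those longer by one edge whose first two edges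
   and last edge satisfy [D]. *)
Definition attained W : Prop := forall i j, (i < M)%N -> (j < M)%N -> 0 < W i j ->
  exists p, [/\ walk (i :: p), last i p = j & wcost (i :: p) = W i j].

Definition relaxed n (D : nat -> nat -> nat -> Prop) W : Prop :=
  [/\ attained W,
      forall i p, walk (i :: p) -> (size p <= n)%N ->
        0 < W i (last i p) <= wcost (i :: p) &
      forall i k p, D i k (last k p) -> walk (i :: k :: p) -> (size p <= n)%N ->
        0 < W i (last k p) <= wcost (i :: k :: p)].

Definition improves W i k j : bool := [&& tfollows i k, 0 < W k j &
  ~~ ((0 < W i j) && (W i j <= co i + W k j))].

Lemma walk_behead i k p : walk (i :: k :: p) ->
  [/\ tfollows i k, (i < M)%N & walk (k :: p)].
Proof.
move=> /and3P[_ /= /andP[f pp] /andP[iM a]].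
by rewrite /walk /= pp.
Qed.

Lemma relaxed_sub n (D D' : nat -> nat -> nat -> Prop) W :
  (forall i k j, (i < M)%N -> (k < M)%N -> (j < M)%N -> D' i k j -> D i k j) ->
  relaxed n D W -> relaxed n D' W.
Proof.
move=> DD [? ? H]; split=> // i k p d w; apply: H => //.
have [_ iM wk] := walk_behead w; have [kM jM] := walk_last wk.
exact: DD.
Qed.

Lemma relaxed_keep n D W i k j : relaxed n D W -> ~~ improves W i k j ->
  relaxed n (fun a b c => D a b c \/ (a = i /\ b = k /\ c = j)) W.
Proof.
move=> [H1 H2 H3] ni; split=> // a b p [?|[ea [eb ec]]] w pn; first exact: H3.
subst a b; have [f iM wk] := walk_behead w.
have /andP[h0 hle] := H2 _ _ wk pn; rewrite ec in h0 hle *.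
move: ni; rewrite /improves f h0 /= negbK => /andP[-> h] /=.
by rewrite wcost_cons (le_trans h) // lerD2l.
Qed.

Lemma relaxed_improve n D W W' i k j : (i < M)%N -> (k < M)%N -> (j < M)%N ->
    relaxed n D W -> improves W i k j ->
    (forall a b, (a < M)%N -> (b < M)%N ->
       W' a b = if (a == i) && (b == j) then co i + W k j else W a b) ->
  relaxed n (fun a b c => D a b c \/ (a = i /\ b = k /\ c = j)) W'.
Proof.
move=> iM kM jM [H1 H2 H3] /and3P[f Wk0 nW] eW.
have dec a b C : (a < M)%N -> (b < M)%N -> 0 < W a b <= C -> 0 < W' a b <= C.
  move=> aM bM; rewrite eW //; case: ifP => // /andP[/eqP -> /eqP ->] /andP[h h'].
  rewrite addr_gt0 ?co_gt0 //=; move: nW; rewrite h /= -ltNge => /ltW.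
  by move=> /le_trans -> .
have [q [wq lq cq]] := H1 _ _ kM jM Wk0.
split.
- move=> a b aM bM; rewrite eW //; case: ifP => [/andP[/eqP -> /eqP ->] _|_ /H1].
    exists (k :: q); split=> //; last by rewrite wcost_cons cq.
    have /and3P[_ h h'] := wq; rewrite /walk /=.
    by rewrite f [path _ _ _]h iM; exact: h'.
  exact.
- by move=> a p w pn; have [aM bM] := walk_last w; apply: dec => //; exact: H2.
- move=> a b p h w pn; have [fab aM wb] := walk_behead w.
  have [bM lM] := walk_last wb.
  case: h => [d|[ea [eb ec]]]; first by apply: dec => //; exact: H3.
  subst a b; rewrite eW // ec !eqxx /= addr_gt0 ?co_gt0 //= wcost_cons lerD2l -ec.
  by have /andP[] := H2 _ _ wb pn.
Qed.

Lemma relaxed_next n W : relaxed n (fun _ _ _ => True) W ->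
  relaxed n.+1 (fun _ _ _ => False) W.
Proof.
move=> [H1 H2 H3]; split=> // i [|k p] w pn; first exact: H2.
exact: (H3 i k p).
Qed.

Lemma relaxed_start W :
  (forall i j, (i < M)%N -> (j < M)%N -> W i j = if i == j then co i else 0) ->
  relaxed 0 (fun _ _ _ => False) W.
Proof.
move=> eW; split=> // [i j iM jM|i [|//] w _].
  rewrite eW //; case: eqP => [<- _|_]; last by rewrite ltxx.
  by exists [::]; rewrite /walk /wcost big_seq1 /= iM.
have [iM _] := walk_last w.
by rewrite /= eW // eqxx co_gt0 //= /wcost big_seq1.
Qed.

Lemma wcost_sub (u v : seq nat) : uniq u -> {subset u <= v} -> all (gtn M) v ->
  wcost u <= wcost v.
Proof.
elim: u v => [|i u IH] v /=; first by move=> _ _ /wcost_ge0; rewrite /wcost big_nil.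
move=> /andP[iu uu] sub av'.
have iv : i \in v by apply: sub; rewrite mem_head.
rewrite /wcost (perm_big _ (perm_to_rem iv)) -!/(wcost _) !wcost_cons lerD2l.
apply: IH => //.
  move=> j ju; have : j \in i :: rem i v.
    by rewrite -(perm_mem (perm_to_rem iv)) sub // inE ju orbT.
  by rewrite inE => /orP[/eqP ej|//]; rewrite ej (negbTE iu) in ju.
by apply/allP => j /mem_rem; exact: (allP av').
Qed.

Lemma relaxed_mincost D W : relaxed M D W -> mincost W.
Proof.
move=> [H1 H2 _] i j iM jM; split; first exact: H1.
move=> p /and3P[_ pp ap] lp; move: pp lp => /= pp.
case: (shortenP pp) => q pq uq sub lq.
have aq : all (gtn M) (i :: q).
  apply/allP => k kq; apply: (allP ap); move: kq.
  by rewrite !inE => /orP[->//|/sub ->]; rewrite orbT.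
have w : walk (i :: q) by rewrite /walk aq andbT.
rewrite -lq; have [|-> h] := andP (H2 _ _ w _).
  suff : (size (i :: q) <= M)%N by move=> /= /ltnW.
  rewrite -(size_iota 0 M); apply: uniq_leq_size => // k kq.
  by rewrite mem_iota add0n; exact: (allP aq).
apply: (le_trans h); apply: wcost_sub => // k.
by rewrite !inE => /orP[->//|/sub ->]; rewrite orbT.
Qed.

End Walks.

(** * The program *)

Definition beq (a b : nexpr) : bexpr := BAnd (BLe a b) (BLe b a).
Definition bor (a b : bexpr) : bexpr := BNot (BAnd (BNot a) (BNot b)).

(* Work words: 0 = length of the current prefix, 1 = candidate next edge,
   2 = "the candidate extends to a solution", 3 = "it completes a solution",
   4 = "dominated", 5 to 8 = loop counters, 9 + l = edge l of the prefix.
   Cost cells: l = cost of the first l edges of the prefix,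
   M + 1 + (i * M + j) = least cost of a walk from edge i to edge j, where 0
   means that there is none. *)
Definition nedges : nexpr := NInput (NConst 1).
Definition field (k : nat) (i : nexpr) : nexpr :=
  NInput (NAdd (NConst k) (NMul (NConst 4) i)).
Definition wcell (i j : nexpr) : nexpr :=
  NAdd (NAdd nedges (NConst 1)) (NAdd (NMul i nedges) j).
Definition eduration (i j : nexpr) : nexpr :=
  NSub (NAdd (field 6 j) (field 7 j)) (field 6 i).
Definition bfollows (i j : nexpr) : bexpr :=
  BAnd (beq (field 5 i) (field 4 j)) (BLe (NAdd (field 6 i) (field 7 i)) (field 6 j)).
Definition bpos (c : cexpr) : bexpr := BNot (BCLe c CZero).
Definition edge_at (l : nexpr) : nexpr := NLoad (NAdd (NConst 9) l).

Definition wsum : cexpr := CAdd (CInput (var 5)) (CLoad (wcell (var 6) (var 7))).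
Definition bimproves : bexpr :=
  BAnd (bpos (CLoad (wcell (var 6) (var 7))))
    (BNot (BAnd (bpos (CLoad (wcell (var 5) (var 7))))
                (BCLe (CLoad (wcell (var 5) (var 7))) wsum))).
Definition relax_row : cmd :=
  For 7 (If bimproves (CStore (wcell (var 5) (var 7)) wsum) Skip).
Definition relax_all : cmd :=
  For 5 (For 6 (If (bfollows (var 5) (var 6)) relax_row Skip)).
Definition init_diag : cmd := For 5 (CStore (wcell (var 5) (var 5)) (CInput (var 5))).
Definition init_table : cmd := Seq init_diag (For 8 relax_all).

Definition total : cexpr := CAdd (CLoad (var 0)) (CLoad (wcell (var 1) (var 5))).
Definition bdominated : bexpr :=
  let w := CLoad (wcell (var 6) (var 7)) in
  let d := eduration (var 6) (var 7) in
  let d' := eduration (edge_at (NConst 0)) (var 5) in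
  BAnd (beq (field 4 (var 6)) (NInput (NConst 2)))
  (BAnd (beq (field 5 (var 7)) (NInput (NConst 3)))
  (BAnd (bpos w)
  (BAnd (BCLe w total) (BAnd (BLe d d') (BNot (BAnd (BCLe total w) (BLe d' d))))))).
Definition test_dominated : cmd :=
  Seq (NStore (NConst 4) (NConst 0))
    (For 6 (For 7 (If bdominated (NStore (NConst 4) (NConst 1)) Skip))).
Definition test_candidate : cmd :=
  For 5 (If (BAnd (beq (field 5 (var 5)) (NInput (NConst 3)))
                  (bpos (CLoad (wcell (var 1) (var 5)))))
    (Seq test_dominated
      (If (BLe (var 4) (NConst 0))
        (Seq (NStore (NConst 2) (NConst 1))
          (If (beq (var 5) (var 1)) (NStore (NConst 3) (NConst 1)) Skip))
        Skip))
    Skip).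
Definition bvalid : bexpr :=
  bor (BAnd (BLe (var 0) (NConst 0)) (beq (field 4 (var 1)) (NInput (NConst 2))))
      (BAnd (BNot (BLe (var 0) (NConst 0)))
            (bfollows (edge_at (NSub (var 0) (NConst 1))) (var 1))).
Definition pop : cmd :=
  Seq (NStore (NConst 0) (NSub (var 0) (NConst 1)))
      (NStore (NConst 1) (NAdd (edge_at (var 0)) (NConst 1))).
Definition push : cmd :=
  Seq (CStore (NAdd (var 0) (NConst 1)) (CAdd (CLoad (var 0)) (CInput (var 1))))
    (Seq (NStore (NConst 0) (NAdd (var 0) (NConst 1)))
         (NStore (NConst 1) (NConst 0))).
Definition search_step : cmd :=
  Seq (NStore (NConst 3) (NConst 0))
    (If (BLe nedges (var 1)) pop
      (Seq (NStore (NConst 2) (NConst 0))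
        (Seq (NStore (NAdd (NConst 9) (var 0)) (var 1))
          (Seq (If bvalid test_candidate Skip)
            (If (BLe (NConst 1) (var 2)) push
              (NStore (NConst 1) (NAdd (var 1) (NConst 1)))))))).
Definition emit_word : cmd :=
  For 5 (If (blt (var 5) (var 0)) (Emit (edge_at (var 5))) Skip).
Definition unfinished : bexpr :=
  BAnd (BNot (beq (NInput (NConst 2)) (NInput (NConst 3))))
       (BNot (BAnd (BLe nedges (var 1)) (BLe (var 0) (NConst 0)))).
Definition bsolution : bexpr := BLe (NConst 1) (var 3).
Definition mcf_program : cmd :=
  Seq init_table (enum_loop search_step emit_word unfinished bsolution).

(* [v] comes after [w] in depth-first order and is not below a child of [w]
   smaller than [c]. *)
Fixpoint lexge (w : seq nat) (c : nat) (v : seq nat) : bool :=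
  match w, v with
  | [::], y :: _ => (c <= y)%N
  | a :: w', y :: v' => (a < y)%N || (a == y) && lexge w' c v'
  | _, [::] => false
  end.

Lemma lexge_pop M w a c v : all (gtn M) v -> (M <= c)%N ->
  lexge (rcons w a) c v = lexge w a.+1 v.
Proof.
move=> + Mc; elim: w v => [|b w IH] [|y v] //= /andP[yM vM]; last by rewrite IH.
case: v vM => [|y' v] /=; first by rewrite andbF orbF.
by move=> /andP[yM' _]; rewrite [(c <= y')%N]leqNgt (leq_trans yM' Mc) andbF orbF.
Qed.

Lemma lexge_next w c v : lexge w c v = lexge w c.+1 v || prefix (rcons w c) v.
Proof.
elim: w v => [|a w IH] [|y v] //=; first by rewrite prefix0s andbT leq_eqVlt orbC.
by rewrite IH andb_orr orbA.
Qed.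

Lemma lexge_push w c v : lexge w c v = lexge (rcons w c) 0 v || (v == rcons w c).
Proof.
elim: w v => [|a w IH] [|y v] //=; last by rewrite IH andb_orr orbA eqseq_cons [y == a]eq_sym.
by rewrite leq_eqVlt eqseq_cons [y == c]eq_sym; case: v => [|y' v] //=;
   rewrite ?andbT ?andbF ?orbF // orbC.
Qed.

Lemma lexge_self w : lexge w 0 w = false.
Proof. by elim: w => //= a w ->; rewrite ltnn eqxx. Qed.

Fixpoint words_upto (M n : nat) : seq (seq nat) :=
  if n is n'.+1 then
    [::] :: [seq i :: v | i <- iota 0 M, v <- words_upto M n']
  else [:: [::]].

Lemma mem_words_upto M n v : all (gtn M) v -> (size v <= n)%N -> v \in words_upto M n.
Proof.
elim: n v => [|n IH] [|i v] //= /andP[iM vM] vn; rewrite inE /=.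
by apply: allpairs_f; [rewrite mem_iota | exact: IH].
Qed.

Section Program.
Variables (R : realType) (x : input R).
Let inw k := nth 0%N (words x) k.
Let M := inw 1.
Let s := inw 2.
Let z := inw 3.
Let sr i := inw (4 + 4 * i).
Let ds i := inw (5 + 4 * i).
Let av i := inw (6 + 4 * i).
Let tr i := inw (7 + 4 * i).
Let co i := nth 0 (costs x) i.
Hypothesis co_gt0 : forall i, (i < M)%N -> 0 < co i.

Let S := (M * M * M * M + M * M + 2 * M + 20)%N.
Let wp := wp x M S.

Local Notation swalk := (swalk M s sr ds av tr).
Local Notation tfollows := (tfollows sr ds av tr).
Local Notation mincost := (mincost M sr ds av tr co).
Local Notation relaxed := (relaxed M sr ds av tr co).
Local Notation improves := (improves sr ds av tr co).

Definition waddr (i j : nat) : nat := (M + 1 + (i * M + j))%N.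
Definition table (m : state R) (i j : nat) : R := (crd m (waddr i j)).1.

Lemma waddr_inj i j i' j' : (j < M)%N -> (j' < M)%N ->
  (waddr i j == waddr i' j') = (i == i') && (j == j').
Proof.
move=> jM jM'; rewrite /waddr eqn_add2l; apply/eqP/andP => [e|[/eqP-> /eqP->]//].
have M0 : (0 < M)%N by lia.
have := congr1 (divn^~ M) e; rewrite !divnMDl // !divn_small // !addn0 => ei.
by split; apply/eqP => //; move: e; rewrite ei => /addnI.
Qed.

Lemma waddr_lt i j : (i < M)%N -> (j < M)%N -> (waddr i j < S)%N.
Proof.
move=> iM jM; have : (i.+1 * M <= M * M)%N by rewrite leq_mul2r iM orbT.
by rewrite mulSn /waddr /S; lia.
Qed.

Lemma table_cupd m i j v a b : (a < M)%N -> (b < M)%N -> (j < M)%N ->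
  table (cupd m (waddr i j) v) a b =
  if (a == i) && (b == j) then v.1 else table m a b.
Proof. by move=> aM bM jM; rewrite /table crd_cupd waddr_inj //; case: ifP. Qed.

(** ** The table of least costs *)

Definition fresh (m : state R) : Prop :=
  [/\ rd m 0 = 0%N, rd m 1 = 0%N, crd m 0 = (0, 0%N) & pending m = [::]].

Definition weights_le (n : nat) (m : state R) : Prop :=
  forall a, ((crd m a).2 <= n)%N.

Definition lex3 (i k j a b c : nat) : Prop :=
  (a < i)%N \/ (a = i /\ ((b < k)%N \/ (b = k /\ (c < j)%N))).

Definition bellman_ford (r i k j : nat) (m : state R) : Prop :=
  [/\ fresh m, weights_le (((r * M + i) * M + k) * M + j).+1 m &
    relaxed r (lex3 i k j) (table m)].

Lemma fresh_upd m a v : (1 < a)%N -> fresh m -> fresh (upd m a v).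
Proof. by case: a => [|[|a]] // _ [? ? ? ?]; split; rewrite ?rd_upd. Qed.

Lemma fresh_cupd m a v : (0 < a)%N -> fresh m -> fresh (cupd m a v).
Proof. by case: a => // a _ [? ? ? ?]; split; rewrite ?crd_cupd. Qed.

Lemma bellman_ford_upd r i k j m a v : (1 < a)%N ->
  bellman_ford r i k j m -> bellman_ford r i k j (upd m a v).
Proof. by move=> a1 [? ? ?]; split=> //; exact: fresh_upd. Qed.

Lemma weights_leW n n' m : (n <= n')%N -> weights_le n m -> weights_le n' m.
Proof. by move=> nn H a; apply: leq_trans (H a) nn. Qed.

Lemma bellman_ford_endj r i k m :
  bellman_ford r i k M m -> bellman_ford r i k.+1 0 m.
Proof.
move=> [? w rx]; split=> //; first by apply: weights_leW w; lia.
by apply: relaxed_sub rx => a b c aM bM cM; rewrite /lex3; lia.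
Qed.

Lemma bellman_ford_endk r i m :
  bellman_ford r i M 0 m -> bellman_ford r i.+1 0 0 m.
Proof.
move=> [? w rx]; split=> //; first by apply: weights_leW w; lia.
by apply: relaxed_sub rx => a b c aM bM cM; rewrite /lex3; lia.
Qed.

Lemma bellman_ford_endi r m :
  bellman_ford r M 0 0 m -> bellman_ford r.+1 0 0 0 m.
Proof.
move=> [? w rx]; split=> //; first by apply: weights_leW w; lia.
apply: (@relaxed_sub _ _ _ _ _ _ _ _ (fun _ _ _ => False)).
  by move=> a b c _ _ _; rewrite /lex3; lia.
apply: relaxed_next; apply: relaxed_sub rx => a b c aM bM cM _.
by left.
Qed.

Lemma bellman_ford_keep r i k j m : (i < M)%N -> (k < M)%N ->
  bellman_ford r i k j m -> ~~ improves (table m) i k j ->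
  bellman_ford r i k j.+1 m.
Proof.
move=> iM kM [? w rx] ni; split=> //; first by apply: weights_leW w; lia.
apply: relaxed_sub (relaxed_keep rx ni) => a b c aM bM cM.
by rewrite /lex3; lia.
Qed.

Lemma bellman_ford_skip r i k m : (i < M)%N -> (k < M)%N ->
  bellman_ford r i k 0 m -> ~~ tfollows i k -> bellman_ford r i k.+1 0 m.
Proof.
move=> iM kM bf nf; apply: bellman_ford_endj.
have : (M <= M)%N by []; elim: {1 3}M => // j IH jM.
by apply: bellman_ford_keep => //; [apply: IH; lia | rewrite /improves (negbTE nf)].
Qed.

Lemma bellman_ford_improve r i k j m w : (i < M)%N -> (k < M)%N -> (j < M)%N ->
  bellman_ford r i k j m -> improves (table m) i k j ->
  w = (co i + table m k j, ((crd m (waddr k j)).2.+1)%N) ->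
  bellman_ford r i k j.+1 (cupd m (waddr i j) w).
Proof.
move=> iM kM jM [? wl rx] im ->; split.
- by apply: fresh_cupd => //; rewrite /waddr; lia.
- move=> a; rewrite crd_cupd addnS; case: ifP => _ /=; first by rewrite ltnS; exact: wl.
  by apply: leqW; exact: wl.
apply: (@relaxed_sub _ _ _ _ _ _ _ _
  (fun a b c => lex3 i k j a b c \/ (a = i /\ b = k /\ c = j))).
  by move=> a b c aM bM cM; rewrite /lex3; lia.
by apply: relaxed_improve rx im _ => // a b aM bM; exact: table_cupd.
Qed.

Lemma rdE (m : state R) a : nth 0%N (nmem m) a = rd m a.
Proof. by []. Qed.

Lemma bimprovesE m i k j : rd m 5 = i -> rd m 6 = k -> rd m 7 = j ->
  tfollows i k -> beval x m bimproves = improves (table m) i k j.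
Proof.
by move=> <- <- <- f; rewrite /improves f /= -!ltNge.
Qed.

Lemma bfollowsE m a b i j : neval x m a = i -> neval x m b = j ->
  beval x m (bfollows a b) = tfollows i j.
Proof. by move=> <- <-; rewrite /tfollows eqn_leq. Qed.

Lemma S_gt k : (k <= 19)%N -> (k < S)%N.
Proof. by rewrite /S; lia. Qed.

Lemma M_le_S : (M <= S)%N.
Proof. by rewrite /S; lia. Qed.

Lemma relax_weight r i k j : (r < M)%N -> (i < M)%N -> (k < M)%N -> (j < M)%N ->
  ((((r * M + i) * M + k) * M + j).+2 <= S)%N.
Proof.
move=> rM iM kM jM.
have h1 : (r * M + i < M * M)%N.
  by have := leq_mul rM (leqnn M); rewrite mulSn; lia.
have h2 : ((r * M + i) * M + k < M * M * M)%N.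
  by have := leq_mul h1 (leqnn M); rewrite mulSn; lia.
have h3 : (((r * M + i) * M + k) * M + j < M * M * M * M)%N.
  by have := leq_mul h2 (leqnn M); rewrite mulSn; lia.
by rewrite /S; lia.
Qed.

Lemma wp_relax_row r i k m : (r < M)%N -> (i < M)%N -> (k < M)%N -> tfollows i k ->
  rd m 8 = r -> rd m 5 = i -> rd m 6 = k -> bellman_ford r i k 0 m ->
  wp relax_row (fun m' => [/\ rd m' 8 = r, rd m' 5 = i, rd m' 6 = k &
                              bellman_ford r i k.+1 0 m']) m.
Proof.
move=> rM iM kM f r8 r5 r6 bf.
apply: (@wp_for _ _ _ _ 7 _ (fun j m' => [/\ rd m' 8 = r, rd m' 5 = i, rd m' 6 = k &
   bellman_ford r i k j m'])) => //; rewrite ?M_le_S ?S_gt //.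
- by split; rewrite ?rd_upd //; exact: bellman_ford_upd.
- move=> j m' jM r7 [r8' r5' r6' bf']; apply: wp_if.
  + rewrite (bimprovesE r5' r6' r7 f) => im; have [_ wl _] := bf'.
    have e1 : neval x m' (wcell (var 5) (var 7)) = waddr i j.
      by rewrite /= !rdE r5' r7.
    have e2 : ceval x m' wsum =
        (co i + table m' k j, ((crd m' (waddr k j)).2.+1)%N).
      by rewrite /= !rdE r5' r6' r7 add1n.
    apply: wp_cstore; rewrite ?e1 ?e2 ?waddr_lt //.
      by apply: leq_trans (relax_weight rM iM kM jM); rewrite ltnS; exact: wl.
    split=> //; split; rewrite ?rd_upd //.
    by apply: bellman_ford_upd => //; exact: bellman_ford_improve.
  + rewrite (bimprovesE r5' r6' r7 f) => im; apply: wp_skip.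
    split=> //; split; rewrite ?rd_upd //.
    by apply: bellman_ford_upd => //; exact: bellman_ford_keep.
- by move=> m' [-> -> -> /bellman_ford_endj].
Qed.

Lemma wp_relax_all r m : (r < M)%N -> rd m 8 = r -> bellman_ford r 0 0 0 m ->
  wp relax_all (fun m' => rd m' 8 = r /\ bellman_ford r.+1 0 0 0 m') m.
Proof.
move=> rM r8 bf.
apply: (@wp_for _ _ _ _ 5 _ (fun i m' => rd m' 8 = r /\ bellman_ford r i 0 0 m'))
  => //; rewrite ?M_le_S ?S_gt //.
- by split; rewrite ?rd_upd //; exact: bellman_ford_upd.
- move=> i m1 iM r5 [r81 bf1].
  apply: (@wp_for _ _ _ _ 6 _ (fun k m' => [/\ rd m' 8 = r, rd m' 5 = i &
    bellman_ford r i k 0 m'])) => //; rewrite ?M_le_S ?S_gt //.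
  + by split; rewrite ?rd_upd //; exact: bellman_ford_upd.
  + move=> k m2 kM r6 [r82 r52 bf2]; apply: wp_if.
    * rewrite (bfollowsE (i := i) (j := k)) //= => f.
      apply: wp_mono (wp_relax_row rM iM kM f r82 r52 r6 bf2).
      move=> m3 [r83 r53 r63 bf3]; split=> //; split; rewrite ?rd_upd //.
      exact: bellman_ford_upd.
    * rewrite (bfollowsE (i := i) (j := k)) //= => f; apply: wp_skip.
      split=> //; split; rewrite ?rd_upd //.
      by apply: bellman_ford_upd => //; exact: bellman_ford_skip.
  + move=> m2 [r82 r52 /bellman_ford_endk bf2]; split=> //.
    by split; rewrite ?rd_upd //; exact: bellman_ford_upd.
- by move=> m1 [r81 /bellman_ford_endi].
Qed.

Lemma wp_init_table :
  wp init_table (fun m => fresh m /\ mincost (table m)) (init_state R).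
Proof.
apply: wp_seq.
apply: (@wp_for _ _ _ _ 5 _ (fun i m => [/\ fresh m, weights_le 1 m &
   forall a b, (a < M)%N -> (b < M)%N ->
     table m a b = if (a == b) && (a < i)%N then co a else 0]))
  => //; rewrite ?M_le_S ?S_gt //.
- split=> //.
  + by move=> a; rewrite /crd /= nth_nil.
  + by move=> a b _ _; rewrite andbF /table /crd /= nth_nil.
- move=> i m iM r5 [fm wm tm].
  have e1 : neval x m (wcell (var 5) (var 5)) = waddr i i by rewrite /= !rdE r5.
  have e2 : ceval x m (CInput (var 5)) = (co i, 1%N) by rewrite /= !rdE r5.
  apply: wp_cstore; rewrite ?e1 ?e2 ?waddr_lt ?S_gt //.
  split=> //; split.
  + by apply: fresh_upd => //; apply: fresh_cupd => //; rewrite /waddr; lia.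
  + by move=> a; rewrite [crd _ _]crd_cupd; case: ifP => // _; exact: wm.
  + move=> a b aM bM; rewrite [table _ _ _]table_cupd // tm // ltnS [in RHS]leq_eqVlt.
    case: (eqVneq a i) => [->|//] /=.
    by rewrite ltnn andbF andbT eq_sym; case: eqP.
- move=> m [fm wm tm].
  apply: (@wp_for _ _ _ _ 8 _ (fun r m => bellman_ford r 0 0 0 m)) => //;
    rewrite ?M_le_S ?S_gt //.
  + apply: bellman_ford_upd => //; split=> //.
    apply: (@relaxed_sub _ _ _ _ _ _ _ _ (fun _ _ _ => False)).
      by move=> a b c _ _ _; rewrite /lex3; lia.
    apply: relaxed_start => // a b aM bM; rewrite tm //; case: eqP => //= _.
    by rewrite aM.
  + move=> r m1 rM r8 bf; apply: wp_mono (wp_relax_all rM r8 bf).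
    by move=> m2 [r8' bf']; split=> //; exact: bellman_ford_upd.
  + by move=> m1 [f1 _ rx]; split=> //; exact: relaxed_mincost rx.
Qed.

(** ** One step of the search *)

Local Notation efficient_word := (efficient_word M s z sr ds av tr co).
Local Notation completes := (completes M s z sr ds av tr co).
Local Notation wdur := (wdur av tr).
Local Notation wcost := (wcost co).

Definition frame (X : seq nat) (m0 m : state R) : Prop :=
  [/\ forall a, a \notin X -> rd m a = rd m0 a, cmem m = cmem m0 &
    pending m = pending m0].

Definition flag (m : state R) (a : nat) (P : Prop) : Prop :=
  exists b : bool, rd m a = b /\ (b <-> P).

Lemma frame_upd X m0 m a v : a \in X -> frame X m0 m -> frame X m0 (upd m a v).
Proof.
move=> aX [H ? ?]; split=> // b bX; rewrite rd_upd; case: eqP => [ba|_]; last exact: H.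
by rewrite ba aX in bX.
Qed.

Lemma frame_trans X Y m0 m1 m2 : {subset Y <= X} ->
  frame X m0 m1 -> frame Y m1 m2 -> frame X m0 m2.
Proof.
move=> YX [H1 c1 p1] [H2 c2 p2]; split; rewrite ?c2 ?p2 // => a aX.
by rewrite H2 ?H1 //; apply: contra aX => /YX.
Qed.

Lemma frame_table X m0 m : frame X m0 m -> table m = table m0.
Proof. by move=> [_ e _]; rewrite /table /crd e. Qed.

Lemma frame_crd X m0 m a : frame X m0 m -> crd m a = crd m0 a.
Proof. by move=> [_ e _]; rewrite /crd e. Qed.

Lemma flag_iff m a P Q : (P <-> Q) -> flag m a P -> flag m a Q.
Proof. by move=> [PQ QP] [b [e [h1 h2]]]; exists b; split; [|split; auto]. Qed.

Lemma flag_rd m m' a P : rd m' a = rd m a -> flag m a P -> flag m' a P.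
Proof. by move=> e [b [e' h]]; exists b; rewrite e. Qed.

Definition hits (m : state R) (c : R) (d a b : nat) : bool :=
  [&& sr a == s, ds b == z, 0 < table m a b &
      dominates (table m a b) c (wdur a b) d].

Lemma undominated_hits m c d :
  undominated M s z sr ds av tr (table m) c d <->
  ~ exists a b, [/\ (a < M)%N, (b < M)%N & hits m c d a b].
Proof.
split=> [H [a [b [aM bM /and4P[/eqP h1 /eqP h2 h3 h4]]]]|H a b aM bM h1 h2 h3].
  by have := H a b aM bM h1 h2 h3; rewrite h4.
apply/negP => h4; apply: H; exists a, b; split=> //.
by rewrite /hits h1 h2 !eqxx h3.
Qed.

Lemma bdominatedE m : beval x m bdominated =
  hits m ((crd m (rd m 0)).1 + table m (rd m 1) (rd m 5))
    (wdur (rd m 9) (rd m 5)) (rd m 6) (rd m 7).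
Proof. by rewrite /hits /dominates !eqn_leq ltNge. Qed.

Lemma wp_test_dominated m c d :
    (crd m (rd m 0)).1 + table m (rd m 1) (rd m 5) = c ->
    wdur (rd m 9) (rd m 5) = d ->
  wp test_dominated (fun m' => frame [:: 4; 6; 7]%N m m' /\
    flag m' 4 (exists a b, [/\ (a < M)%N, (b < M)%N & hits m c d a b])) m.
Proof.
move=> ec ed; apply: wp_seq; apply: wp_nstore => //=; first exact: S_gt.
set m0 := upd m 4 0; set X := [:: 4; 6; 7]%N.
have fr0 : frame X m m0 by exact: frame_upd.
apply: (@wp_for _ _ _ _ 6 _ (fun i m' => frame X m m' /\
  flag m' 4 (exists a b, [/\ (a < i)%N, (b < M)%N & hits m c d a b])))
  => //; rewrite ?M_le_S ?S_gt //.
  split; first exact: frame_upd.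
  by exists false; rewrite !rd_upd; split=> //; split=> // -[a [b []]].
move=> i m1 iM r6 [fr1 fl1].
apply: (@wp_for _ _ _ _ 7 _ (fun j m' => [/\ frame X m m', rd m' 6 = i &
  flag m' 4 (exists a b, [/\ (a < i \/ a = i /\ b < j)%N, (b < M)%N & hits m c d a b])]))
  => //; rewrite ?M_le_S ?S_gt //.
- split; rewrite ?rd_upd //; first exact: frame_upd.
  apply: flag_rd (flag_iff _ fl1); first by rewrite rd_upd.
  split=> -[a [b [h1 h2 h3]]]; exists a, b; split=> //; last by lia.
  by left.
- move=> j m2 jM r7 [fr2 r62 fl2].
  have hE : beval x m2 bdominated = hits m c d i j.
    have [f2 _ _] := fr2; rewrite bdominatedE r62 r7 !f2 //.
    by rewrite (frame_crd _ fr2) /hits (frame_table fr2) -ec -ed.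
  apply: wp_if; rewrite hE => hij.
    apply: wp_nstore => //=; rewrite ?S_gt // rd_upd /= r7; split=> //.
    split; rewrite ?rd_upd //; first by do 2?apply: frame_upd.
    exists true; rewrite !rd_upd; split=> //; split=> // _.
    by exists i, j; split=> //; right.
  apply: wp_skip; split=> //; split; rewrite ?rd_upd //; first exact: frame_upd.
  apply: flag_rd (flag_iff _ fl2); first by rewrite rd_upd.
  split=> -[a [b [h1 h2 h3]]]; exists a, b; split=> //; first by lia.
  suff : ~ (a = i /\ b = j) by lia.
  by move=> [ea eb]; rewrite ea eb (negbTE hij) in h3.
- move=> m2 [fr2 r62 fl2]; split=> //.
  split; first exact: frame_upd.
  apply: flag_rd (flag_iff _ fl2); first by rewrite rd_upd.
  split=> -[a [b [h1 h2 h3]]]; exists a, b; split=> //; first by lia.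
  by move: h1; lia.
Qed.

Definition candidate (m : state R) (u : seq nat) (i : nat) : Prop :=
  [/\ rd m 0 = size u, rd m 1 = i, (i < M)%N, rd m 9 = head 0%N (rcons u i) &
    crd m (size u) = (wcost u, size u)].

Lemma wp_test_candidate m u i : s != z -> mincost (table m) ->
    swalk (rcons u i) -> candidate m u i -> rd m 2 = 0%N -> rd m 3 = 0%N ->
  wp test_candidate (fun m' => [/\ frame [:: 2; 3; 4; 5; 6; 7]%N m m',
    flag m' 2 (exists v, efficient_word (rcons u i ++ v)) &
    flag m' 3 (efficient_word (rcons u i))]) m.
Proof.
move=> sz mc sw [r0 r1 iM r9 cu] r2 r3; set X := [:: 2; 3; 4; 5; 6; 7]%N.
pose P j := completes (table m) u i j.
apply: (@wp_for _ _ _ _ 5 _ (fun j m' => [/\ frame X m m',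
  flag m' 2 (exists2 k, (k < j)%N & P k) & flag m' 3 ((i < j)%N /\ P i)]))
  => //; rewrite ?M_le_S ?S_gt //.
- split; first exact: frame_upd.
  + by exists false; rewrite rd_upd r2; split=> //; split=> // -[].
  + by exists false; rewrite rd_upd r3; split=> //; split=> // -[].
- move=> j m1 jM r5 [fr1 fl2 fl3].
  have [f1 _ _] := fr1.
  have keep (m2 : state R) : ~ P j -> frame X m m2 -> rd m2 2 = rd m1 2 ->
      rd m2 3 = rd m1 3 -> [/\ frame X m (upd m2 5 j.+1),
      flag (upd m2 5 j.+1) 2 (exists2 k, (k < j.+1)%N & P k) &
      flag (upd m2 5 j.+1) 3 ((i < j.+1)%N /\ P i)].
    move=> nP fr2 e2 e3; split; first exact: frame_upd.
    + apply: flag_rd (flag_iff _ fl2); first by rewrite rd_upd.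
      split=> -[k kj Pk]; exists k => //; first by lia.
      by rewrite ltnS leq_eqVlt in kj; case/orP: kj => // /eqP kj; case: nP; rewrite -kj.
    + apply: flag_rd (flag_iff _ fl3); first by rewrite rd_upd.
      split=> -[ij Pi]; split=> //; first by lia.
      by rewrite ltnS leq_eqVlt in ij; case/orP: ij => // /eqP ij; case: nP; rewrite -ij.
  have bE : beval x m1 (BAnd (beq (field 5 (var 5)) (NInput (NConst 3)))
      (bpos (CLoad (wcell (var 1) (var 5))))) = (ds j == z) && (0 < table m i j).
    by rewrite -(frame_table fr1) -r1 -r5 -(f1 1%N) // eqn_leq ltNge.
  apply: wp_if; rewrite bE; last first.
    move=> n; apply: wp_skip; split=> //; apply: keep => // -[h1 h2 _].
    by case/negP: n; rewrite h1 eqxx.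
  move=> /andP[/eqP dz W0]; apply: wp_seq.
  pose c := wcost u + table m i j; pose d := wdur (head 0%N (rcons u i)) j.
  have E1 : (crd m1 (rd m1 0)).1 + table m1 (rd m1 1) (rd m1 5) = c.
    by rewrite !(f1 0%N, f1 1%N) // r0 r1 r5 (frame_crd _ fr1) (frame_table fr1) cu.
  have E2 : wdur (rd m1 9) (rd m1 5) = d by rewrite (f1 9) // r9 r5.
  apply: wp_mono (wp_test_dominated E1 E2) => m2 [fr2 [b [r4 hb]]].
  have fr12 : frame X m m2 by apply: frame_trans fr1 fr2 => // a; rewrite !inE; lia.
  have [f2 _ _] := fr2.
  have PE : P j <-> ~~ b.
    rewrite /hits (frame_table fr1) in hb; split.
      move=> [_ _ /undominated_hits nh]; apply/negP => /hb; exact: nh.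
    move=> /negP nb; split=> //; apply/undominated_hits => h; apply: nb.
    exact/hb.
  have e5 : rd m2 5 = j by rewrite f2.
  apply: wp_if.
    rewrite /= rdE r4 => b0; have {b0}bF : ~~ b by case: (b) b0.
    have Pj : P j by apply/PE.
    apply: wp_seq; apply: wp_nstore => //=; rewrite ?S_gt //.
    set m3 := upd m2 2 1; have fr3 : frame X m m3 by exact: frame_upd.
    have fl2' (m4 : state R) : rd m4 2 = 1%N ->
        flag (upd m4 5 j.+1) 2 (exists2 k, (k < j.+1)%N & P k).
      by move=> e; exists true; rewrite rd_upd e; split=> //; split=> // _; exists j.
    have e51 : beval x m3 (beq (var 5) (var 1)) = (j == i).
      rewrite -[beval _ _ _]/((rd m3 5 <= rd m3 1) && (rd m3 1 <= rd m3 5))%N.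
      by rewrite -eqn_leq !rd_upd e5 (let: And3 f _ _ := fr12 in f 1%N) //= r1.
    apply: wp_if; rewrite e51 => ji.
      apply: wp_nstore => //=; rewrite ?S_gt // !rd_upd /= e5; split=> //.
      split; first by do 2?apply: frame_upd.
        by apply: fl2'; rewrite !rd_upd.
      exists true; rewrite !rd_upd; split=> //; split=> // _.
      by move: Pj; rewrite (eqP ji) ltnSn.
    apply: wp_skip; rewrite rd_upd /= e5; split=> //; split; first exact: frame_upd.
      by apply: fl2'; rewrite !rd_upd.
    apply: flag_rd (flag_iff _ fl3); first by rewrite !rd_upd /= f2.
    split=> -[ij Pi]; split=> //; first by lia.
    by move/eqP: ji => ji; lia.
  rewrite /= rdE r4 => b0; have {b0}bT : b by case: (b) b0.
  apply: wp_skip; split=> //; apply: keep => //.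
  + by move=> /PE; rewrite bT.
  + by rewrite f2.
  + by rewrite f2.
- move=> m1 [fr1 fl2 fl3]; split=> //.
  + by apply: flag_iff fl2; exact: extensionP.
  + apply: flag_iff fl3; rewrite iM -(completionP co_gt0 sz mc sw).
    by split=> [[]|].
Qed.

Definition at_prefix (m : state R) (w : seq nat) (c : nat) : Prop :=
  [/\ rd m 0 = size w, rd m 1 = c,
      forall i, (i < size w)%N -> rd m (9 + i) = nth 0%N w i,
      forall i, (i <= size w)%N -> crd m i = (wcost (take i w), i) &
      mincost (table m) /\ pending m = [::]].

Definition extendible (w : seq nat) : Prop := exists v, efficient_word (w ++ v).

Lemma at_prefix_frame m m' w c X : all (fun a => 1 < a < 9)%N X ->
  frame X m m' -> at_prefix m w c -> at_prefix m' w c.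
Proof.
move=> /allP aX fr [h0 h1 h2 h3 h4]; have [f _ ep] := fr.
have nX a : (a <= 1)%N || (9 <= a)%N -> a \notin X.
  by move=> h; apply/negP => /aX; lia.
split; rewrite ?f ?nX //; last by rewrite (frame_table fr) ep.
- by move=> i iw; rewrite f ?nX ?leq_addr ?orbT //; exact: h2.
- by move=> i iw; rewrite (frame_crd _ fr); exact: h3.
Qed.

Lemma bvalidE m w c : (c < M)%N -> w = [::] \/ swalk w ->
  rd m 0 = size w -> rd m 1 = c ->
  (forall i, (i < size w)%N -> rd m (9 + i) = nth 0%N w i) ->
  beval x m bvalid = swalk (rcons w c).
Proof.
move=> cM hw r0 r1 rw.
have -> : beval x m bvalid = ~~ (~~ ((rd m 0 <= 0)%N && (sr (rd m 1) == s)) &&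
    ~~ ((0 < rd m 0)%N && tfollows (rd m (9 + (rd m 0 - 1))) (rd m 1))).
  by rewrite ltnNge /tfollows !eqn_leq.
rewrite r0 r1 negb_and !negbK.
case: hw => [->|sw] /=; first by rewrite /swalk /walk /= cM orbF.
rewrite swalk_rcons //; case: w sw rw {r0} => // i w sw rw.
by rewrite [(size (i :: w) <= 0)%N]/= andFb orFb rw ?subn1 // nth_last.
Qed.

Lemma wp_valid_candidate m w c : s != z -> (c < M)%N -> w = [::] \/ swalk w ->
    at_prefix m w c -> rd m (9 + size w) = c -> rd m 2 = 0%N -> rd m 3 = 0%N ->
  wp (If bvalid test_candidate Skip) (fun m' => [/\
    frame [:: 2; 3; 4; 5; 6; 7]%N m m', flag m' 2 (extendible (rcons w c)) &
    flag m' 3 (efficient_word (rcons w c))]) m.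
Proof.
move=> sz cM hw [r0 r1 rw cw [mc _]] rc r2 r3.
apply: wp_if; rewrite (bvalidE cM hw r0 r1 rw) => sw.
  apply: wp_test_candidate => //; split=> //; last by rewrite cw // take_size.
  by case: (w) rw rc => [|i w'] //= /(_ 0%N isT).
have n v : ~ efficient_word (rcons w c ++ v).
  move=> [/andP[h _] _ _]; case/negP: sw; apply: swalk_prefix h.
  by case: (w).
apply: wp_skip; split=> //.
  by exists false; split=> //; split=> // -[v /n].
by exists false; split=> //; split=> //; rewrite -[rcons w c]cats0 => /n.
Qed.

Lemma wp_pop m w a c : at_prefix m (rcons w a) c -> (size w < M)%N -> (a < M)%N ->
  wp pop (fun m' => at_prefix m' w a.+1 /\ rd m' 3 = rd m 3) m.
Proof.
move=> [r0 r1 rw cw [mc pe]] wM aM.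
have e0 : (rd m 0 - 1 = size w)%N by rewrite r0 size_rcons subn1.
apply: wp_seq; apply: wp_nstore; rewrite /= ?rdE ?e0 ?S_gt //.
  by rewrite (leq_trans (ltnW wM)) ?M_le_S.
set m1 := upd m 0 _.
have ea : neval x m1 (NAdd (edge_at (var 0)) (NConst 1)) = a.+1.
  have r10 : rd m1 0 = size w by rewrite rd_upd.
  rewrite -[LHS]/(rd m1 (9 + rd m1 0) + 1)%N r10 rd_upd /=.
  by rewrite rw ?size_rcons // nth_rcons ltnn eqxx addn1.
have MS := M_le_S; apply: wp_nstore; rewrite ?ea /=; [exact: S_gt|lia|].
rewrite !rd_upd /=; split=> //; split; rewrite ?rd_upd //.
- move=> i iw; rewrite !rd_upd /= rw ?size_rcons; last by lia.
  by rewrite nth_rcons iw.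
- move=> i iw; rewrite [crd _ _]cw ?size_rcons; last by lia.
  by rewrite -cats1 takel_cat.
Qed.

Lemma wp_push m w c : at_prefix m w c -> rd m (9 + size w) = c ->
  (size w < M)%N -> (c < M)%N ->
  wp push (fun m' => at_prefix m' (rcons w c) 0 /\ rd m' 3 = rd m 3) m.
Proof.
move=> [r0 r1 rw cw [mc pe]] rc wM cM.
have MS := M_le_S.
have e : ceval x m (CAdd (CLoad (var 0)) (CInput (var 1))) =
    (wcost w + co c, (size w).+1).
  by rewrite /= !rdE r0 r1 -[nth _ (cmem m) _]/(crd m _) cw //= take_size addn1.
apply: wp_seq; apply: wp_cstore; rewrite ?e /= ?rdE ?r0 ?addn1.
- by rewrite /S; lia.
- by lia.
set m1 := cupd m _ _.
apply: wp_seq; apply: wp_nstore; rewrite /= -?[nth _ _ 0]/(rd m 0) ?r0 ?addn1.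
- exact: S_gt.
- by lia.
apply: wp_nstore; rewrite /= ?S_gt //.
rewrite !rd_upd /=; split=> //; split; rewrite ?rd_upd ?size_rcons //.
- move=> i iw; rewrite !rd_upd /= nth_rcons -[rd m1 _]/(rd m _).
  case: ltngtP => [/rw -> //|iw'|->//]; first by lia.
- move=> i iw; rewrite -[crd _ _]/(crd m1 i) crd_cupd; case: eqP => [->|ni].
    by rewrite -(size_rcons w c) take_size wcost_rcons.
  by rewrite cw -?cats1 ?takel_cat //; lia.
split=> //.
have et i j : (i < M)%N -> (j < M)%N -> table m1 i j = table m i j.
  move=> iM jM; rewrite /table crd_cupd; case: eqP => // ea.
  by move: ea; rewrite /waddr; lia.
by move=> i j iM jM; rewrite [table _ _ _]et //; exact: mc.
Qed.

Lemma efficient_word_bounds v : efficient_word v -> all (gtn M) v /\ (size v <= M)%N.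
Proof.
move=> ev; split; last exact: efficient_word_size ev.
by have [/andP[/andP[/and3P[]]]] := ev.
Qed.

Definition step_result (m1 : state R) (w : seq nat) (c : nat) (b : bool) : Prop :=
  [\/ [/\ (M <= c)%N, ~~ b & exists w' a, w = rcons w' a /\ at_prefix m1 w' a.+1],
      [/\ (c < M)%N, extendible (rcons w c), b <-> efficient_word (rcons w c) &
          at_prefix m1 (rcons w c) 0] |
      [/\ (c < M)%N, ~ extendible (rcons w c), ~~ b & at_prefix m1 w c.+1]].

Lemma wp_search_step m w c : s != z -> at_prefix m w c -> (c <= M)%N ->
    w = [::] \/ extendible w -> (c < M)%N || (w != [::]) ->
  wp search_step (fun m1 => exists b : bool, rd m1 3 = b /\ step_result m1 w c b) m.
Proof.
move=> sz ap cM hw nonempty.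
have MS := M_le_S.
have [aw wM] : all (gtn M) w /\ (size w <= M)%N.
  case: hw => [->//|[v /efficient_word_bounds[]]]; rewrite all_cat size_cat.
  by move=> /andP[-> _]; lia.
have hw' : w = [::] \/ swalk w.
  case: (eqVneq w [::]) hw => [|w0 [|[v [/andP[h _] _ _]]]]; try by left.
  by right; exact: swalk_prefix h.
apply: wp_seq; apply: wp_nstore; rewrite /= ?S_gt //.
set m1 := upd m 3 0; have ap1 : at_prefix m1 w c.
  by apply: (@at_prefix_frame m _ _ _ [:: 3%N]) => //; exact: frame_upd.
have r13 : rd m1 3 = 0%N by rewrite rd_upd.
move: {ap} m1 ap1 r13 => {}m ap r3; have [r0 r1 _ _ _] := ap.
apply: wp_if; rewrite /= rdE r1 -/(inw 1) -/M => Mc.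
  case: (lastP w) aw wM ap nonempty => [|w' a] {}aw {}wM {}ap.
    by rewrite orbF ltnNge Mc.
  move=> _; apply: wp_mono (wp_pop ap _ _).
  - move=> m1 [ap1 r13]; exists false; rewrite r13; split=> //.
    by apply: Or31; split=> //; exists w', a.
  - by rewrite size_rcons in wM.
  - by move: aw; rewrite all_rcons => /andP[].
rewrite -ltnNge in Mc.
apply: wp_seq; apply: wp_nstore; rewrite /= ?S_gt //.
set m1 := upd m 2 0; have ap1 : at_prefix m1 w c.
  by apply: (@at_prefix_frame m _ _ _ [:: 2%N]) => //; exact: frame_upd.
have r12 : rd m1 2 = 0%N by rewrite rd_upd.
have r13 : rd m1 3 = 0%N by rewrite rd_upd.
move: {ap r0 r1 r3} m1 ap1 r12 r13 => {}m ap r2 r3; have [r0 r1 rw cw mcp] := ap.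
apply: wp_seq; apply: wp_nstore; rewrite /= !rdE ?r0 ?r1.
- by rewrite /S; lia.
- by lia.
set m1 := upd m _ c; have ap1 : at_prefix m1 w c.
  split; rewrite ?rd_upd //.
  by move=> i iw; rewrite rd_upd eqn_add2l ltn_eqF //; exact: rw.
have rc : rd m1 (9 + size w) = c by rewrite rd_upd eqxx.
have r12 : rd m1 2 = 0%N by rewrite rd_upd.
have r13 : rd m1 3 = 0%N by rewrite rd_upd.
apply: wp_seq; apply: wp_mono (wp_valid_candidate sz Mc hw' ap1 rc r12 r13).
move=> m2 [fr [be [e2 hbe]] [bs [e3 hbs]]].
have ap2 : at_prefix m2 w c by exact: at_prefix_frame fr ap1.
have rc2 : rd m2 (9 + size w) = c.
  by have [-> //] := fr; rewrite !inE; lia.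
apply: wp_if; rewrite /= rdE e2 => hb.
  have {hb} eb : extendible (rcons w c) by apply/hbe; case: (be) hb.
  have sM : (size w < M)%N.
    have [v /efficient_word_bounds[_]] := eb.
    by rewrite size_cat size_rcons; lia.
  apply: wp_mono (wp_push ap2 rc2 sM Mc) => m3 [ap3 r33].
  by exists bs; rewrite r33; split=> //; apply: Or32.
have {hb} nb : ~ extendible (rcons w c) by move=> /hbe bT; rewrite bT in hb.
have nbs : ~~ bs.
  by apply/negP => /hbs h; apply: nb; exists [::]; rewrite cats0.
have [_ r21 _ _ _] := ap2.
apply: wp_nstore; rewrite /= ?rdE ?r21 ?addn1; [exact: S_gt|lia|].
exists bs; rewrite rd_upd; split=> //; apply: Or33; split=> //.
have [h0 h1 h2 h3 h4] := ap2; split; rewrite ?rd_upd //.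
by move=> i iw; rewrite rd_upd; exact: h2.
Qed.

Lemma wp_emit_word m w c : at_prefix m w c -> (size w <= M)%N ->
  wp emit_word (fun m' => at_prefix (flush m') w c /\ pending m' = w) m.
Proof.
move=> [r0 r1 rw cw [mc pe]] wM.
apply: (@wp_for _ _ _ _ 5 _ (fun i m' => [/\
  forall a, a != 5 -> rd m' a = rd m a, cmem m' = cmem m & pending m' = take i w]))
  => //; rewrite ?M_le_S ?S_gt //.
- split=> //; last by rewrite take0.
  by move=> a /negbTE a5; rewrite rd_upd a5.
- move=> i m1 iM r5 [f ec ep].
  have bE : beval x m1 (blt (var 5) (var 0)) = (i < size w)%N.
    by rewrite -r0 -(f 0%N) // -r5 ltnNge.
  apply: wp_if; rewrite bE => iw.
    have ei : neval x m1 (edge_at (var 5)) = nth 0%N w i.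
      by rewrite -[LHS]/(rd m1 (9 + rd m1 5)) r5 f // rw.
    apply: wp_emit; rewrite ei; split=> //; split=> //=.
      by move=> a a5; rewrite rd_upd (negbTE a5); exact: f.
    by rewrite ep -take_nth.
  apply: wp_skip; split=> //; split=> //=.
    by move=> a a5; rewrite rd_upd (negbTE a5); exact: f.
  by rewrite -leqNgt in iw; rewrite ep !take_oversize //; lia.
- move=> m1 [f ec ep]; split; last by rewrite ep take_oversize.
  have fr : frame [:: 5]%N m (flush m1).
    by split=> //= a; rewrite inE => /f.
  exact: at_prefix_frame fr _.
Qed.

(** ** The whole search *)

Let far := (M.+1 * M.+1)%N.

(* Decreases at every step without output: fewer than [far] steps remain once
   a solution is known to lie ahead below the current prefix, and the first
   alternative covers the backtracking that precedes this. *)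
Definition countdown (w : seq nat) (c u : nat) : Prop :=
  u = (far + (size w * M.+1 + (M - c)))%N \/
  (exists c' v, (c <= c')%N /\ efficient_word (w ++ c' :: v)) /\
  u = ((M - size w) * M.+1 + (M - c))%N.

Definition searching (u : nat) (m : state R) : Prop := exists w c,
  [/\ at_prefix m w c, (c <= M)%N, w = [::] \/ extendible w, countdown w c u &
   [/\ uniq (outputs m), forall v, v \in outputs m -> efficient_word v &
     forall v, efficient_word v -> (v \in outputs m) = ~~ lexge w c v]].

Lemma size_le w : w = [::] \/ extendible w -> (size w <= M)%N.
Proof.
by case=> [->//|[v /efficient_word_bounds[_]]]; rewrite size_cat; lia.
Qed.

Lemma countdown_le w c u : (size w <= M)%N -> countdown w c u -> (u <= far + far)%N.
Proof.
move=> wM; have h1 : (size w * M.+1 <= M * M.+1)%N by rewrite leq_mul2r wM orbT.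
have h2 : ((M - size w) * M.+1 <= M * M.+1)%N by rewrite leq_mul2r leq_subr orbT.
have -> : far = (M.+1 + M * M.+1)%N by rewrite /far mulSn.
by case=> [->|[_ ->]]; lia.
Qed.

Lemma countdown_pop w a c u : (M <= c)%N -> (a < M)%N -> countdown (rcons w a) c u ->
  exists2 u', (u' < u)%N & countdown w a.+1 u'.
Proof.
move=> Mc aM; case=> [->|[[c' [v [cc' /efficient_word_bounds[+ _]]]] _]].
  exists (far + (size w * M.+1 + (M - a.+1)))%N; last by left.
  by rewrite size_rcons mulSn; lia.
by rewrite all_cat /= => /and3P[_ c'M _]; lia.
Qed.

Lemma countdown_next w c u : (c < M)%N -> ~ extendible (rcons w c) -> countdown w c u ->
  exists2 u', (u' < u)%N & countdown w c.+1 u'.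
Proof.
move=> cM nx; case=> [->|[[c' [v [cc' ev]]] ->]].
  by exists (far + (size w * M.+1 + (M - c.+1)))%N; [lia | left].
exists ((M - size w) * M.+1 + (M - c.+1))%N; first by lia.
right; split=> //; exists c', v; split=> //.
rewrite ltn_neqAle cc' andbT; apply/eqP => e; apply: nx; exists v.
by rewrite cat_rcons e.
Qed.

Lemma countdown_push w c u : (c < M)%N -> extendible (rcons w c) ->
  ~ efficient_word (rcons w c) -> countdown w c u ->
  exists2 u', (u' < u)%N & countdown (rcons w c) 0 u'.
Proof.
move=> cM [v ev] nw cd; have wM : (size w < M)%N.
  by have [_] := efficient_word_bounds ev; rewrite size_cat size_rcons; lia.
exists ((M - size (rcons w c)) * M.+1 + (M - 0))%N; last first.
  right; split=> //; case: v ev => [|c' v] ev; first by rewrite cats0 in ev.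
  by exists c', v.
rewrite size_rcons.
have e : ((M - size w) * M.+1 = M.+1 + (M - (size w).+1) * M.+1)%N.
  by rewrite -mulSn; congr (_ * _)%N; lia.
have h : ((M - (size w).+1) * M.+1 <= M * M.+1)%N by rewrite leq_mul2r leq_subr orbT.
have ef : far = (M.+1 + M * M.+1)%N by rewrite /far mulSn.
by case: cd => [->|[_ ->]]; lia.
Qed.

Lemma unfinishedE m : beval x m unfinished =
  (s != z) && ~~ ((M <= rd m 1) && (rd m 0 <= 0))%N.
Proof. by rewrite eqn_leq. Qed.

Lemma wp_searching u m : searching u m -> beval x m unfinished ->
  wp search_step (fun m1 => if beval x m1 bsolution
    then wp emit_word (fun m2 => exists2 u', (u' <= far + far)%N &
                                             searching u' (flush m2)) m1
    else exists2 u', (u' < u)%N & searching u' m1) m.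
Proof.
move=> [w [c [ap cM hw cd [uo so co']]]].
have [r0 r1 _ _ _] := ap; rewrite unfinishedE r0 r1 => /andP[sz ne].
have wM := size_le hw.
have {}ne : (c < M)%N || (w != [::]).
  by move: ne; rewrite negb_and -ltnNge leqn0 size_eq0.
apply: wp_mono (wp_outputs (wp_search_step sz ap cM hw ne)) => m1 [[b [r3 st]] eo].
have -> : beval x m1 bsolution = b by rewrite /= rdE r3; case: (b).
case: st => [[Mc /negbTE -> [w' [a [ew ap']]]]|[cM' ex hb ap']|[cM' nx /negbTE -> ap']].
- subst w; case: hw => [w0|[v ev]]; first by case: (w') w0.
  have [vM _] := efficient_word_bounds ev.
  have aM : (a < M)%N by move: vM; rewrite all_cat all_rcons => /andP[/andP[]].
  have [u' uu' cd'] := countdown_pop Mc aM cd; exists u' => //.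
  exists w', a.+1; rewrite eo; split=> //; first by right; exists (a :: v); rewrite -cat_rcons.
  split=> // v' ev'; rewrite co' // (lexge_pop _ _ _ Mc) //.
  by have [] := efficient_word_bounds ev'.
- have wcM : (size (rcons w c) <= M)%N by apply: size_le; right.
  case: ifP => bT; last first.
    have nw : ~ efficient_word (rcons w c) by move=> /hb; rewrite bT.
    have [u' uu' cd'] := countdown_push cM' ex nw cd; exists u' => //.
    exists (rcons w c), 0%N; rewrite eo; split=> //; first by right.
    split=> // v ev; rewrite co' // lexge_push; case: eqP => [e|_]; last by rewrite orbF.
    by rewrite e in ev.
  have ew : efficient_word (rcons w c) by apply/hb.
  apply: wp_mono (wp_outputs (wp_emit_word ap' wcM)) => m2 [[ap2 pe2] eo2].
  have cd2 : countdown (rcons w c) 0 (far + (size (rcons w c) * M.+1 + (M - 0))) by left.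
  exists (far + (size (rcons w c) * M.+1 + (M - 0)))%N; first exact: countdown_le cd2.
  exists (rcons w c), 0%N; rewrite /= pe2 eo2 eo; split=> //; first by right.
  have nin : rcons w c \notin outputs m.
    by rewrite co' // lexge_push eqxx orbT.
  split.
  + by rewrite rcons_uniq nin.
  + by move=> v; rewrite mem_rcons inE => /orP[/eqP->|/so].
  + move=> v ev; rewrite mem_rcons inE co' // [lexge w c v]lexge_push.
    by case: eqP => [->|_] /=; rewrite ?lexge_self // orbF.
- have [u' uu' cd'] := countdown_next cM' nx cd; exists u' => //.
  exists w, c.+1; rewrite eo; split=> //; split=> // v ev.
  rewrite co' // lexge_next; case: prefixP => [[v' e]|_]; last by rewrite orbF.
  by case: nx; exists v'; rewrite -e.
Qed.

Lemma searching_outputs u m : searching u m ->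
  (size (outputs m) <= size (words_upto M M))%N.
Proof.
move=> [w [c [_ _ _ _ [uo so _]]]]; apply: uniq_leq_size => // v /so ev.
by have [? ?] := efficient_word_bounds ev; exact: mem_words_upto.
Qed.

Lemma wp_searching_init : wp init_table
  (fun m => exists2 u, (u <= far + far)%N & searching u m) (init_state R).
Proof.
apply: wp_mono (wp_outputs wp_init_table) => m [[[r0 r1 c0 pe] mc] eo].
have cd : countdown [::] 0 (far + (0 * M.+1 + (M - 0))) by left.
exists (far + (0 * M.+1 + (M - 0)))%N; first exact: countdown_le cd.
exists [::], 0%N; rewrite eo; split=> //; [|by left|].
- split=> // i; rewrite leqn0 => /eqP ->.
  by rewrite c0 /wcost big_nil.
- by split=> // -[|i v] // [].
Qed.

Lemma searching_finished u m : searching u m -> ~~ beval x m unfinished ->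
  uniq (outputs m) /\ forall v, v \in outputs m <-> efficient_word v.
Proof.
move=> [w [c [[r0 r1 _ _ _] _ _ _ [uo so co']]]].
rewrite unfinishedE r0 r1 negb_and !negbK => fin; split=> // v; split; first exact: so.
move=> ev; case/orP: fin => [/eqP sz|/andP[Mc w0]].
  have [/andP[/andP[/and3P[v0 _ _] _] /eqP ez] /= /andP[/negP []]] := ev.
  rewrite sz -ez; apply: map_f; case: (v) v0 => // i v' _; exact: mem_last.
rewrite co' //; move: w0; rewrite leqn0 size_eq0 => /eqP ->.
have [vM _] := efficient_word_bounds ev; case: (v) vM => //= i v' /andP[iM _].
by rewrite -ltnNge (leq_trans iM Mc).
Qed.

Definition delay_bound : nat := (time_bound M init_table +
  (far + far).+1 * (time_bound M search_step + time_bound M emit_word + 6) + 1)%N.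

Lemma mcf_programP : exists D, [/\ (D <= delay_bound)%N,
  exists T, [/\ halted (run mcf_program x T), uniq (outputs (run mcf_program x T).2) &
    forall v, v \in outputs (run mcf_program x T).2 <-> efficient_word v],
  forall t, (space (run mcf_program x t) <= (S * S.+1).*2)%N &
  delay_le mcf_program x D].
Proof.
have S0 : (0 < S)%N by rewrite S_gt.
have [D [De [T [m [u [eT su fin]]]] gd dl]] :=
  enum_loopP wp_searching_init wp_searching searching_outputs S0.
exists D; split=> //; last by move=> t; exact: good_space.
have [uo ho] := searching_finished su fin.
by exists T; rewrite /halted [run _ _ _]eT.
Qed.

End Program.

(** * Correspondence with temporal graphs, and polynomial bounds *)

Lemma nth_flatten4 (T : Type) (f : T -> seq nat) e0 (E : seq T) i r :
  (forall e, size (f e) = 4) -> (i < size E)%N -> (r < 4)%N ->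
  nth 0%N (flatten (map f E)) (r + 4 * i) = nth 0%N (f (nth e0 E i)) r.
Proof.
move=> f4; elim: E i => //= e E IH [|i] iE r4; rewrite nth_cat f4.
  by rewrite muln0 addn0 r4.
rewrite (_ : (r + 4 * i.+1 < 4)%N = false); last by lia.
by rewrite (_ : r + 4 * i.+1 - 4 = r + 4 * i)%N ?IH //; lia.
Qed.

Section Graph.
Variables (R : realType) (X : mcf_instance R).
Hypothesis X_pos : forall e, e \in tedges (mgraph X) -> 0 < cost e.

Let E := tedges (mgraph X).
Let M := size E.
Let x := mcf_encode X.
Let inw k := nth 0%N (words x) k.
Let sr i := inw (4 + 4 * i).
Let ds i := inw (5 + 4 * i).
Let av i := inw (6 + 4 * i).
Let tr i := inw (7 + 4 * i).
Let co i := nth 0 (costs x) i.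
Let s : nat := msource X.
Let z : nat := mtarget X.
Let e0 : tedge R (nvert (mgraph X)) := TEdge (msource X) (msource X) 0 0 0.
Let ed i := nth e0 E i.
Local Notation stwalk := (stwalk M s z sr ds av tr).
Local Notation simple := (simple s ds).
Local Notation efficient_word := (efficient_word M s z sr ds av tr co).

Lemma fields i : (i < M)%N ->
  [/\ sr i = src (ed i), ds i = dst (ed i), av i = avail (ed i) &
      tr i = trav (ed i)].
Proof.
move=> iM.
have nf r : (r < 4)%N -> inw (4 + r + 4 * i) =
    nth 0%N [:: val (src (ed i)); val (dst (ed i)); avail (ed i); trav (ed i)] r.
  move=> r4; rewrite /inw -addnA; exact: (@nth_flatten4 _
    (fun e => [:: val (src e); val (dst e); avail e; trav e]) e0 E i r).
by split; [exact: (nf 0%N)|exact: (nf 1%N)|exact: (nf 2%N)|exact: (nf 3%N)].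
Qed.

Lemma co_cost i : (i < M)%N -> co i = cost (ed i).
Proof. by move=> iM; rewrite /co /= (nth_map e0). Qed.

Lemma co_pos i : (i < M)%N -> 0 < co i.
Proof. by move=> iM; rewrite co_cost // X_pos // mem_nth. Qed.

Lemma simpleE v : all (gtn M) v ->
  uniq (msource X :: map (@dst R _) (map ed v)) = simple v.
Proof.
move=> /allP vM; rewrite -(map_inj_uniq (@ord_inj _)) /simple.
rewrite map_cons -!map_comp.
suff -> : map ((@nat_of_ord _ \o @dst R _) \o ed) v = map ds v by [].
by apply/eq_in_map => a /vM aM /=; have [_ -> _ _] := fields aM.
Qed.

Lemma is_tpathE v : all (gtn M) v ->
  is_tpath (msource X) (mtarget X) (map ed v) = stwalk v && simple v.
Proof.
case: v => // i p vM; have /andP[iM pM] := vM.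
have lM : (last i p < M)%N by apply: (allP vM); exact: mem_last.
have [si _ _ _] := fields iM; have [_ dl _ _] := fields lM.
have U := simpleE vM.
transitivity [&& all (mem E) (map ed (i :: p)), src (ed i) == msource X,
    dst (last (ed i) (map ed p)) == mtarget X,
    path (@follows R _) (ed i) (map ed p) & simple (i :: p)]; first by rewrite -U.
have -> : all (mem E) (map ed (i :: p)).
  by rewrite all_map; apply: sub_all vM => a aM; exact: mem_nth.
rewrite /stwalk /swalk /walk vM [head _ _]/= [last _ (_ :: _)]/= si dl.
rewrite last_map path_map -!val_eqE /= -/(simple (i :: p)).
have -> : path (relpre ed (@follows R _)) i p = path (tfollows sr ds av tr) i p.
  apply: (@eq_in_path _ (gtn M)) vM => a b aM bM.
  have [_ d1 a1 t1] := fields aM; have [s2 _ a2 _] := fields bM.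
  by rewrite /tfollows d1 a1 t1 s2 a2.
by rewrite andbT; case: (path _ _ _); rewrite ?andbF ?andFb ?andbT //= andbA.
Qed.

Lemma path_costE v : all (gtn M) v -> path_cost (map ed v) = wcost co v.
Proof.
move=> vM; rewrite /path_cost big_map /wcost; apply: eq_big_seq => i /(allP vM) iM.
by rewrite co_cost.
Qed.

Lemma durationE v : all (gtn M) v -> v != [::] -> duration (map ed v) = span av tr v.
Proof.
case: v => // i p vM _; have /andP[iM _] := vM.
have lM : (last i p < M)%N by apply: (allP vM); exact: mem_last.
have [_ _ ai _] := fields iM; have [_ _ al tl] := fields lM.
by rewrite /duration /span /wdur /= last_map ai al tl.
Qed.

Lemma mapK_index P : all (mem E) P -> map ed (map (index^~ E) P) = P.
Proof.
move=> /allP PE; rewrite -map_comp; apply: map_id_in => e /PE eE /=.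
by rewrite /ed nth_index.
Qed.

Lemma mapK_nth v : all (gtn M) v -> map (index^~ E) (map ed v) = v.
Proof.
move=> /allP vM; rewrite -map_comp; apply: map_id_in => i /vM iM /=.
by rewrite /ed index_uniq // tedges_uniq.
Qed.

Lemma tpath_edges P : is_tpath (msource X) (mtarget X) P ->
  all (mem E) P /\ all (gtn M) (map (index^~ E) P).
Proof.
case: P => // e P /and5P[PE _ _ _ _]; split=> //.
by rewrite all_map; apply: sub_all PE => f fE; rewrite /= index_mem.
Qed.

Lemma efficientE v : all (gtn M) v ->
  efficient (msource X) (mtarget X) (map ed v) <-> efficient_word v.
Proof.
move=> vM; rewrite /efficient is_tpathE //; split.
  move=> [/andP[sv iv] H]; split=> // q sq iq; apply/negP => /dominatesE h; apply: H.
  have qM : all (gtn M) q by move: sq => /andP[/andP[/and3P[]]].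
  have q0 : q != [::] by move: sq => /andP[/andP[/and3P[]]].
  have v0 : v != [::] by move: sv => /andP[/andP[/and3P[]]].
  by exists (map ed q); rewrite is_tpathE // sq iq !path_costE // !durationE.
move=> [sv iv H]; split; first by rewrite sv.
move=> [Q [tQ h]]; have [QE qM] := tpath_edges tQ.
move: tQ h; rewrite -(mapK_index QE); move: qM; set q := map _ Q => qM.
rewrite is_tpathE // => /andP[sq iq] h; case/negP: (H q sq iq); apply/dominatesE.
have q0 : q != [::] by move: sq => /andP[/andP[/and3P[]]].
have v0 : v != [::] by move: sv => /andP[/andP[/and3P[]]].
by rewrite !path_costE // !durationE // in h.
Qed.

Lemma solutionE v :
  (exists2 P, efficient (msource X) (mtarget X) P & v = map (index^~ E) P) <->
  efficient_word v.
Proof.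
split=> [[P eP ->]|ev].
  have [PE qM] := tpath_edges eP.1.
  by apply/(efficientE qM); rewrite mapK_index.
have vM : all (gtn M) v by have [/andP[/andP[/and3P[]]]] := ev.
by exists (map ed v); [apply/efficientE | rewrite mapK_nth].
Qed.

End Graph.

Definition poly_bounded (f : nat -> nat) : Prop :=
  exists D : {poly nat}, forall a b, (a <= b)%N -> (f a <= D.[b])%N.

Lemma poly_bounded_const k : poly_bounded (fun=> k).
Proof. by exists (k%:P) => a b _; rewrite hornerC. Qed.

Lemma poly_bounded_id : poly_bounded id.
Proof. by exists 'X => a b ab; rewrite hornerX. Qed.

Lemma poly_bounded_add f g : poly_bounded f -> poly_bounded g ->
  poly_bounded (fun n => f n + g n)%N.
Proof.
move=> [D HD] [D' HD']; exists (D + D') => a b ab.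
by rewrite hornerD leq_add ?HD ?HD'.
Qed.

Lemma poly_bounded_mul f g : poly_bounded f -> poly_bounded g ->
  poly_bounded (fun n => f n * g n)%N.
Proof.
move=> [D HD] [D' HD']; exists (D * D') => a b ab.
by rewrite hornerM leq_mul ?HD ?HD'.
Qed.

Lemma poly_bounded_succ f : poly_bounded f -> poly_bounded (fun n => (f n).+1).
Proof.
move=> /poly_bounded_add /(_ (poly_bounded_const 1)) [D HD].
by exists D => a b /HD; rewrite addn1.
Qed.

Lemma poly_bounded_time c : poly_bounded (fun n => time_bound n c).
Proof.
elim: c => [|a b|a b|a||c IHc d IHd|b c IHc d IHd|b c IHc] /=;
  try exact: poly_bounded_const.
- by apply: poly_bounded_succ; exact: poly_bounded_add.
- by apply: poly_bounded_succ; exact: poly_bounded_add.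
- apply: poly_bounded_succ; apply: poly_bounded_mul; first exact: poly_bounded_id.
  exact: poly_bounded_succ.
Qed.

Ltac poly_bounded := repeat first
  [ exact: poly_bounded_id | exact: poly_bounded_const
  | exact: poly_bounded_time | apply: poly_bounded_succ
  | apply: poly_bounded_add | apply: poly_bounded_mul ].

Theorem theorem2 (R : realType) : PSDelayP (McfEnum_cpos R).
Proof.
pose S n := (n * n * n * n + n * n + 2 * n + 20)%N.
pose far n := (n.+1 * n.+1)%N.
pose d n := (time_bound n init_table +
  (far n + far n).+1 * (time_bound n search_step + time_bound n emit_word + 6)
  + 1)%N.
have [D HD] : poly_bounded d by rewrite /d /far; poly_bounded.
have [P HP] : poly_bounded (fun n => S n * (S n).+1 + S n * (S n).+1)%N.
  by rewrite /S; poly_bounded.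
exists mcf_program, D, P => -[X X_pos] /=.
have MX : (size (tedges (mgraph X)) <= mcf_size X)%N.
  by rewrite /mcf_size /= size_map leq_addl.
have [D' [hD [T [hT uT oT]] sp dl]] := @mcf_programP R (mcf_encode X) (co_pos X_pos).
split.
- exists T; split=> // w; apply: iff_trans (oT w) _.
  exact: iff_sym (@solutionE R X w).
- have {}hD : (D' <= D.[mcf_size X])%N := leq_trans hD (HD _ _ MX).
  by move=> t /dl [t' tt' h]; exists t' => //; lia.
- move=> t; apply: leq_trans (sp t) _.
  by rewrite -addnn; exact: HP MX.
Qed.
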